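(* Consider the Markov chain $(X_n)$ and the observational noise $(\epsilon_n)$ described in the context, with constant modulation $s\equiv s_M>0$. There are constants $C_\epsilon>0$ (depending on the noise $(\epsilon_n)$) and $C_X>0$ (depending on the chain $(X_n)$) such that for every $n\ge1$, every function $K(y_1,\dots,y_n)$ that is separately Lipschitz in each variable $y_j$ with Lipschitz constant $\mathrm{Lip}_j(K)$, and every $t>0$, $$\mathbb P\times\mathbb P_\epsilon\Big(\big|K(X_1+s_M\epsilon_1,\dots,X_n+s_M\epsilon_n)-\mathbb E_{\mathbb P\times\mathbb P_\epsilon}\big(K(X_1+s_M\epsilon_1,\dots,X_n+s_M\epsilon_n)\big)\big|>t\Big)\le 2\exp\left(\frac{-t^2}{4\sum_{j=1}^n\mathrm{Lip}_j(K)^2\,[C_\epsilon s_M^2+C_X]}\right).$$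
   Context: Map and dynamical noise (Assumption TM). $T$ is a continuous unimodal map on $[0,1]$ with a unique maximum at a point $\mathfrak c$, and $\Upsilon:=T(\mathfrak c)<1$; there is a closed interval $[d_1,d_2]\subset[0,1]$, forward invariant under $T$, on which all powers $T^n$, $n\ge1$, are topologically transitive; $T$ preserves a unique absolutely continuous Borel probability measure. Put $\Gamma=1-\Upsilon$, $q=T(0)$ and $I=[-\Gamma,1]$. $T$ is extended to $I$ so that on $[-\Gamma,0]$ it is $C^4$ and decreasing with $T(-\Gamma)<\Upsilon$. $\sigma:\mathbb R\to[0,\infty)$ is differentiable, $\sigma_{\max}=\max_{x\in I}\sigma(x)$, and $a>0$ satisfies $a\le\frac1{\sigma_{\max}}\min\{\frac\Gamma2,\frac q2,\frac12T(1-\frac\Gamma2)\}$. The noises $\eta_0,\eta_1,\dots$ are i.i.d. real random variables with density $g(x)=c_a\chi_a(x)e^{-x^2/2}$, where $\chi_a$ is a $C^\infty$ bump function supported in $[-a,a]$ and $c_a$ is the normalizing constant. The Markov chain is $X_{n+1}=T(X_n)+\sigma(X_n)\eta_n$; its Markov kernel is $p(x,z)=\frac1{\sigma(x)}g\big(\frac{z-T(x)}{\sigma(x)}\big)$ and its Markov operator is $\mathcal Lf(z)=\int f(x)p(x,z)\,dx$. $\mathcal B$ is the space of functions of bounded variation on $I$ with norm $\|f\|_{\mathcal B}=\mathrm{Var}(f)+\|f\|_{L^1}$. The initial law of the chain has a density in $\mathcal B$, and $\mathbb P$ denotes the probability on the space where the chain is defined. Standing facts of the setting: random orbits stay in $[-\Gamma/2,1-\Gamma/2]$;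 there is a unique absolutely continuous stationary probability measure $\mu$, with density supported in $I_\Gamma=[\frac12T(1-\frac\Gamma2),1-\frac\Gamma2]$; $\operatorname{ess\,sup}_x\mathrm{Var}(p(x,\cdot))<\infty$, so $\mathcal L$ is compact on $\mathcal B$; $1$ is a simple eigenvalue of $\mathcal L$ and $\mathcal L$ has a spectral gap. Observational noise. $(\epsilon_n)$ are i.i.d. with values in $[-1,1]$ and law $\psi$, defined on a space with probability $\mathbb P_\epsilon$ and hence independent of the chain under $\mathbb P\times\mathbb P_\epsilon$. The modulation function $s$ is constant, $s\equiv s_M$ (Assumption CI), with $s_M<\Gamma/2$, so that $X_n+s_M\epsilon_n\in I$. *)

(* Defs.v *)
From HB Require Import structures.
From mathcomp Require Import all_boot all_order all_algebra finmap.
From mathcomp Require Import all_classical all_reals all_analysis.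
From mathcomp Require Import ess_sup_inf.

Set Implicit Arguments.
Unset Strict Implicit.
Unset Printing Implicit Defensive.

Import Order.TTheory GRing.Theory Num.Theory.
Import numFieldNormedType.Exports.

Local Open Scope classical_set_scope.
Local Open Scope ring_scope.

Section map.
Context {R : realType}.
Implicit Types (T : R -> R) (c u v : R) (n k : nat).

(* Only the values of T on the interval [-Gamma, 1] are ever constrained. *)
Definition unimodal T c : Prop :=
  [/\ 0 < c < 1,
      {within `[0, 1], continuous T},
      {in `[0, 1], forall x, 0 <= T x <= 1},
      {in `[0, c] &, {homo T : x y / x < y}} &
      {in `[c, 1] &, {homo T : x y / x < y >-> y < x}}].

Definition forward_invariant T u v : Prop :=
  {in `[u, v], forall x, T x \in `[u, v]}.

(* The nonempty relatively open subsets of [u, v] are the U `&` `[u, v] below. *)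
Definition transitive_on T u v : Prop :=
  forall U V : set R, open U -> open V ->
    U `&` `[u, v] !=set0 -> V `&` `[u, v] !=set0 ->
  exists2 x, (U `&` `[u, v]) x &
    exists2 k, (0 < k)%N & (V `&` `[u, v]) (iter k T x).

Definition invariant_ac T (nu : probability (measurableTypeR R) R) : Prop :=
  [/\ nu (`[0, 1]%classic : set R) = 1%E,
      nu `<< (@lebesgue_measure R) &
      forall A : set R, measurable A -> nu ((`[0, 1]%classic : set R) `&` T @^-1` A) = nu A].

Definition unique_invariant_ac T : Prop :=
  (exists nu, invariant_ac T nu) /\
  (forall nu nu', invariant_ac T nu -> invariant_ac T nu' ->
     forall A : set R, measurable A -> nu A = nu' A).

(* C^k on a compact interval: the successive derivatives in the interior extend
   continuously to the endpoints. *)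
Definition Ck_on k (f : R -> R) u v : Prop :=
  exists D : nat -> R -> R,
    [/\ D 0%N = f,
        forall i, (i <= k)%N -> {within `[u, v], continuous (D i)} &
        forall i x, (i < k)%N -> x \in `]u, v[ ->
          is_derive x 1 (D i) (D i.+1 x)].

Definition gap T c : R := 1 - T c.

Definition assumption_map T c d1 d2 : Prop :=
  [/\ unimodal T c /\ T c < 1,
      [/\ 0 <= d1, d1 < d2, d2 <= 1, forward_invariant T d1 d2 &
          forall n, (0 < n)%N -> transitive_on (iter n T) d1 d2],
      unique_invariant_ac T &
      [/\ Ck_on 4 T (- gap T c) 0,
          {in `[- gap T c, 0] &, {homo T : x y / x < y >-> y < x}} &
          T (- gap T c) < T c]].

End map.

Section noise.
Context {R : realType}.
Implicit Types (T sigma chi : R -> R) (c a : R).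

Definition smooth (f : R -> R) : Prop :=
  forall (n : nat) (x : R), derivable (derive1n n f) x 1.

(* chi x = 0 for a < |x| says that the closed support of chi lies in [-a, a]. *)
Definition bump chi a : Prop :=
  [/\ smooth chi, forall x, 0 <= chi x & forall x, a < `|x| -> chi x = 0].

Definition noise_density chi (x : R) : R :=
  (\int[lebesgue_measure]_y (chi y * expR (- (y ^+ 2 / 2))))^-1
  * chi x * expR (- (x ^+ 2 / 2)).

Definition sigma_max T c sigma : R := sup (sigma @` `[- gap T c, 1]).

Definition assumption_noise T c sigma a chi : Prop :=
  [/\ forall x, 0 <= sigma x,
      forall x, derivable sigma x 1,
      0 < a,
      a <= (sigma_max T c sigma)^-1 *
           Num.min (gap T c / 2)
             (Num.min (T 0 / 2) (T (1 - gap T c / 2) / 2)) &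
      bump chi a].

Definition markov_kernel T sigma chi (x z : R) : R :=
  (sigma x)^-1 * noise_density chi ((z - T x) / sigma x).

End noise.

(* B is the space of functions of bounded variation on [l, r]; its elements are
   represented by functions on R, identified when they agree on [l, r]. *)
Section BV.
Context {R : realType} (l r : R).
Implicit Types (f g : R -> R) (A : (R -> R) -> (R -> R)).

Definition BV f : Prop := bounded_variation l r f.

Definition BVnorm f : R :=
  fine (total_variation l r f) + \int[lebesgue_measure]_(x in `[l, r]) `|f x|.

Definition BVeq f g : Prop := {in `[l, r], f =1 g}.

Definition BVoperator A : Prop :=
  [/\ forall f, BV f -> BV (A f),
      forall (k : R) f g, BV f -> BV g ->
        BVeq (A (fun x => k * f x + g x)) (fun x => k * A f x + A g x) &
      exists M : R, forall f, BV f -> BVnorm (A f) <= M * BVnorm f].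

(* Spectral gap with 1 as simple leading eigenvalue: A = Pi + N on B, where Pi is
   a projection of rank one, Pi N = N Pi = 0 and N has spectral radius < 1. *)
Definition spectral_gap A : Prop :=
  exists Pi N : (R -> R) -> (R -> R),
    [/\ BVoperator Pi /\ BVoperator N,
        forall f, BV f -> BVeq (A f) (fun z => Pi f z + N f z),
        exists h : R -> R,
          [/\ BV h, ~ BVeq h (fun=> 0), BVeq (Pi h) h &
              forall f, BV f -> exists k : R, BVeq (Pi f) (fun z => k * h z)],
        forall f, BV f ->
          BVeq (Pi (N f)) (fun=> 0) /\ BVeq (N (Pi f)) (fun=> 0) &
        exists M rho : R, 0 <= rho < 1 /\
          forall (n : nat) f, BV f ->
            BVnorm (iter n N f) <= M * rho ^+ n * BVnorm f].

Definition markov_operator (p : R -> R -> R) f (z : R) : R :=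
  \int[lebesgue_measure]_(x in `[l, r]) (f x * p x z).

Definition esssup_variation (p : R -> R -> R) : \bar R :=
  ess_sup lebesgue_measure ((fun x => total_variation l r (p x)) \_ `[l, r]).

End BV.

Section random_variables.
Context {R : realType} {d : measure_display} {Omega : measurableType d}.
Variable P : probability Omega R.

Definition mutually_independent (Y : nat -> {RV P >-> R}) : Prop :=
  forall (J : {fset nat}) (A : nat -> set R), (forall j, measurable (A j)) ->
    P (\bigcap_(j in [set` J]) (Y j @^-1` A j)) =
    (\prod_(j <- J) P (Y j @^-1` A j))%E.

Definition has_density (Y : {RV P >-> R}) (h : R -> R) : Prop :=
  [/\ measurable_fun [set: R] h, forall x, 0 <= h x &
      forall A : set R, measurable A ->
        distribution P Y A = (\int[lebesgue_measure]_(x in A) (h x)%:E)%E].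

End random_variables.

Record chain (R : realType) : Type := Chain {
  ch_d : measure_display ;
  ch_Omega : measurableType ch_d ;
  ch_P : probability ch_Omega R ;
  ch_T : R -> R ;
  ch_c : R ;
  ch_d1 : R ;
  ch_d2 : R ;
  ch_sigma : R -> R ;
  ch_a : R ;
  ch_chi : R -> R ;
  ch_eta : nat -> {RV ch_P >-> R} ;
  ch_X : nat -> {RV ch_P >-> R} ;
  Gamma := gap ch_T ch_c ;
  ch_p := markov_kernel ch_T ch_sigma ch_chi ;
  ch_map : assumption_map ch_T ch_c ch_d1 ch_d2 ;
  ch_noise : assumption_noise ch_T ch_c ch_sigma ch_a ch_chi ;
  ch_eta_density : forall n, has_density (ch_eta n) (noise_density ch_chi) ;
  (* the initial state and all the noises are jointly independent *)
  ch_independent : mutually_independent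
    (fun n => if n is m.+1 then ch_eta m else ch_X 0%N) ;
  ch_initial : exists h : R -> R,
    [/\ BV (- Gamma) 1 h, forall x, x \notin `[- Gamma, 1] -> h x = 0 &
        has_density (ch_X 0%N) h] ;
  ch_step : forall n w,
    ch_X n.+1 w = ch_T (ch_X n w) + ch_sigma (ch_X n w) * ch_eta n w ;
  (* from time 1 on; the initial state only lies in [-Gamma, 1] almost surely *)
  ch_orbit : forall n w, - (Gamma / 2) <= ch_X n.+1 w <= 1 - Gamma / 2 ;
  ch_esssup : (esssup_variation (- Gamma) 1 ch_p < +oo)%E ;
  ch_spectral_gap : spectral_gap (- Gamma) 1 (markov_operator (- Gamma) 1 ch_p)
}.

Record obs_noise (R : realType) : Type := ObsNoise {
  ob_d : measure_display ;
  ob_Omega : measurableType ob_d ;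
  ob_P : probability ob_Omega R ;
  ob_psi : probability (measurableTypeR R) R ;
  ob_eps : nat -> {RV ob_P >-> R} ;
  ob_range : forall n w, -1 <= ob_eps n w <= 1 ;
  ob_law : forall n (A : set R), measurable A ->
    distribution ob_P (ob_eps n) A = ob_psi A ;
  ob_independent : mutually_independent ob_eps
}.

(* L j is an admissible Lipschitz constant of K in the variable y_j, for K seen as
   a function on D^n; the least such constant is a particular case. *)
Definition separately_lipschitz {R : realType} (D : set R) (n : nat)
    (K : 'rV[R]_n -> R) (L : 'I_n -> R) : Prop :=
  forall (j : 'I_n) (y y' : 'rV[R]_n),
    (forall i, D (y ord0 i)) -> (forall i, D (y' ord0 i)) ->
    (forall i, i != j -> y ord0 i = y' ord0 i) ->
    `|K y - K y'| <= L j * `|y ord0 j - y' ord0 j|.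

(* (X_1 + s eps_1, ..., X_n + s eps_n) on the product space; index j : 'I_n stands
   for time j + 1. *)
Definition observed {R : realType} (X : chain R) (e : obs_noise R) (s : R)
    (n : nat) (w : ch_Omega X * ob_Omega e) : 'rV[R]_n :=
  \row_(j < n) (ch_X X j.+1 w.1 + s * ob_eps e j.+1 w.2).

(* Main.v *)
Require Import Defs.
From HB Require Import structures.
From mathcomp Require Import all_boot all_order all_algebra finmap.
From mathcomp Require Import all_classical all_reals all_analysis.
From mathcomp Require Import measurable_realfun ess_sup_inf ring lra.

Set Implicit Arguments.
Unset Strict Implicit.
Unset Printing Implicit Defensive.

Import Order.TTheory GRing.Theory Num.Theory.
Import numFieldNormedType.Exports.

Local Open Scope classical_set_scope.
Local Open Scope ring_scope.

(** The bound is a martingale concentration inequality.  The chain and the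
observational noise are independent, so the exponential moment of the centred
functional can be estimated in two stages, each of which integrates out the
variables of one of the two sources.

For both sources the variables are generated by an iteration
X_(n+1) = F (X_n, U_(n+1)) with independent U_n, where F (x, u) = u for the
noise.  Let K be a function of X_1, ..., X_n and put
M_j = E (K | X_0, ..., X_j).  By the Markov property M_j is the value at X_j of
an explicit iterated integral ([path_mean]), so that no conditional expectation
has to be constructed.  Given the past, M_(j+1) is a function of the fresh
variable U_(j+1) alone, and Hoeffding's lemma ([hoeffding]) bounds its
exponential moment by its oscillation.  Changing X_(j+1) moves K directly by at
most Lip_(j+1) times the diameter, and it also changes the law of X_(j+1+i); if
the chain forgets its starting point at the rate C rho^i this costs
C rho^i Lip_(j+1+i) more ([path_mean_diag_oscillation]).  The sum over j of the
squares of these discounted sums of Lipschitz constants is at most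
(sum of Lip_j^2) / (1 - rho)^2 ([discounted_squares_le]).  This gives
[random_iteration_concentration].

For the observational noise C = 0 ([iid_concentration]).  For the chain, mixing
comes from the spectral gap.  Transition probabilities have densities p(x, .),
and the markov_operator A is dual to the transition operator, so the difference
of the k+1-step means of H started at x and at x' is the integral of H against
A^k (p(x, .) - p(x', .)).  Since A preserves integrals, the projection onto the
stationary density kills functions of integral zero, hence A^k contracts them
exponentially fast in the norm of bounded variation, which dominates the L^1
norm ([spectral_gap_decay], [spectral_gap_mixing]).  The starting functions are
bounded in that norm uniformly in x and x' because the noise amplitude sigma is
bounded below: were it small but nonzero at one point, it would be so on an
interval, where p(x, .) would have large variation, against the bound on the
essential supremum of the variations ([sigma_lower_bound]).

With B the sum of Lip_j^2 (8 s^2 + C_X), the two stages bound the exponential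
moment at l by exp (l^2 B) ([observed_mgf]); optimizing Markov's inequality over
l gives exp (- t^2 / (4 B)) for each tail ([subgaussian_tail]). *)


(** * Hoeffding's lemma and measurability of parametric functions *)

(** The linear term integrates to zero against a centred variable, which is what
makes Hoeffding's lemma follow by integration.  For x <= 1/2 it comes from
exp x <= 1 / (1 - x) <= 1 + x + 2 x^2, and for larger x from x <= 2 x^2. *)
Lemma expR_le_quadratic {R : realType} (x : R) :
  expR x <= x + expR (2 * x ^+ 2).
Proof.
have e2 := expR_ge1Dx (2 * x ^+ 2).
have [xs|xl] := leP x (1 / 2).
  have px : 0 < 1 - x by lra.
  have e1 : expR x * (1 - x) <= 1.
    have := expR_ge1Dx (- x); rewrite expRN => h.
    by rewrite mulrC -ler_pdivlMr ?expR_gt0// div1r.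
  have : (1 + x + 2 * x ^+ 2) * (1 - x) >= 1 by nra.
  move=> /(le_trans e1); rewrite ler_pM2r//; lra.
have : expR x <= expR (2 * x ^+ 2) by rewrite ler_expR; nra.
by lra.
Qed.

Section probability_integrals.
Context {R : realType} d (T : measurableType d) (P : probability T R).
Implicit Types f g : T -> R.

Lemma bounded_integrable f b :
  measurable_fun setT f -> (forall x, `|f x| <= b) ->
  P.-integrable setT (EFin \o f).
Proof.
move=> mf fb; apply: measurable_bounded_integrable => //.
  by rewrite fin_num_fun_lty//; exact: fin_num_measure.
exists b; split; first exact: num_real.
by move=> M bM x _ /=; rewrite (le_trans (fb x))// ltW.
Qed.

Lemma Rintegral_prob_cst (r : R) : \int[P]_x r = r.
Proof. by rewrite Rintegral_cst// [X in fine X](probability_setT P) mulr1. Qed.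

Lemma Rintegral_prob_le f b :
  measurable_fun setT f -> (forall x, `|f x| <= b) -> `|\int[P]_x f x| <= b.
Proof.
move=> mf fb; apply: le_trans; first exact/le_normr_Rintegral/bounded_integrable.
rewrite -[leRHS]Rintegral_prob_cst; apply: le_Rintegral => //.
- apply: bounded_integrable; first exact: measurableT_comp.
  by move=> x /=; rewrite normr_id; exact: fb.
- by apply: (@bounded_integrable _ `|b|) => //; exact: measurable_cst.
Qed.

Lemma Rintegral_prob_dist f g (b b' c : R) :
  measurable_fun setT f -> measurable_fun setT g ->
  (forall x, `|f x| <= b) -> (forall x, `|g x| <= b') ->
  (forall x, `|f x - g x| <= c) ->
  `|\int[P]_x f x - \int[P]_x g x| <= c.
Proof.
move=> mf mg fb gb fg; rewrite -RintegralB//; [|exact: bounded_integrable..].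
by apply: Rintegral_prob_le => //; exact: measurable_funB.
Qed.

Lemma oscillation_mean f b c x :
  measurable_fun setT f -> (forall x, `|f x| <= b) ->
  (forall x y, `|f x - f y| <= c) -> `|f x - \int[P]_y f y| <= c.
Proof.
move=> mf fb fc; rewrite -{1}(Rintegral_prob_cst (f x)).
by apply: (@Rintegral_prob_dist (fun=> f x) _ `|f x| b c) => //; exact: measurable_cst.
Qed.

(** Hoeffding's lemma with a constant that is not optimal: apply
[expR_le_quadratic] to l (f - E f), whose absolute value is at most l c. *)
Lemma hoeffding f b c l : measurable_fun setT f -> (forall x, `|f x| <= b) ->
  (forall x y, `|f x - f y| <= c) ->
  \int[P]_x expR (l * f x) <= expR (l * \int[P]_x f x + 2 * (l * c) ^+ 2).
Proof.
move=> mf fb fc; set m := \int[P]_x f x.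
have fm x : `|f x - m| <= c by exact: (@oscillation_mean f b).
pose k := expR (2 * (l * c) ^+ 2).
have -> : expR (l * m + 2 * (l * c) ^+ 2) =
    \int[P]_x (expR (l * m) * (l * (f x - m) + k)).
  have i0 : P.-integrable setT (EFin \o (fun x => f x - m)).
    apply: (@bounded_integrable _ c) => //; apply: measurable_funB => //; exact: measurable_cst.
  have i1 : P.-integrable setT (EFin \o (fun x => l * (f x - m))).
    apply: (@bounded_integrable _ (`|l| * c)) => //.
      by apply: measurable_funM; [exact: measurable_cst|apply: measurable_funB => //; exact: measurable_cst].
    by move=> x; rewrite normrM ler_wpM2l.
  have i2 : P.-integrable setT (EFin \o (fun _ : T => k)).
    by apply: (@bounded_integrable _ `|k|) => //; exact: measurable_cst.
  rewrite RintegralZl//; last first.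
    have := integrableD measurableT i1 i2; exact: eq_integrable.
  rewrite RintegralD// RintegralZl// RintegralB//; last 2 first.
  - exact: (@bounded_integrable _ b).
  - by apply: (@bounded_integrable _ `|m|) => //; exact: measurable_cst.
  by rewrite !Rintegral_prob_cst -/m subrr mulr0 add0r expRD.
apply: le_Rintegral => //.
- apply: (@bounded_integrable _ (expR (`|l| * b))).
    by apply: measurableT_comp => //; apply: measurable_funM => //; exact: measurable_cst.
  move=> x; rewrite ger0_norm ?expR_ge0// ler_expR (le_trans (ler_norm _))//.
  by rewrite normrM ler_wpM2l.
- apply: (@bounded_integrable _ (expR (l * m) * (`|l| * c + k))).
    apply: measurable_funM; first exact: measurable_cst.
    apply: measurable_funD; last exact: measurable_cst.
    apply: measurable_funM; first exact: measurable_cst.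
    by apply: measurable_funB => //; exact: measurable_cst.
  move=> x; rewrite normrM ger0_norm ?expR_ge0// ler_pM2l ?expR_gt0//.
  rewrite (le_trans (ler_normD _ _))// lerD//.
    by rewrite normrM ler_wpM2l.
  by rewrite ger0_norm// expR_ge0.
- move=> x _; rewrite -[in leLHS](subrK m (f x)) mulrDr expRD mulrC.
  rewrite ler_pM2l ?expR_gt0//; apply: (le_trans (expR_le_quadratic _)).
  rewrite lerD2l ler_expR ler_pM2l//.
  rewrite -(real_normK (num_real (l * (f x - m)))) -(real_normK (num_real (l * c))).
  rewrite lerXn2r ?nnegrE ?normr_ge0// !normrM ler_wpM2l//.
  by rewrite (le_trans (fm x))// ler_norm.
Qed.

End probability_integrals.

(** A function that is measurable in w and continuous in x is the limit of the
functions in which x is rounded down to a multiple of 1 / (n + 1); these are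
measurable because they involve countably many sections only. *)
Lemma caratheodory_measurable_fun {R : realType} d (T : measurableType d)
    (f : T -> R -> R) :
  (forall x, measurable_fun setT (f^~ x)) -> (forall w, continuous (f w)) ->
  measurable_fun setT (fun p : T * R => f p.1 p.2).
Proof.
move=> mf cf.
pose q n (x : R) : R := (Num.floor (x * n.+1%:R))%:~R / n.+1%:R.
have mq n k : measurable [set x : R | Num.floor (x * n.+1%:R) = k].
  rewrite (_ : [set _ | _] = `[k%:~R / n.+1%:R, (k + 1)%:~R / n.+1%:R[%classic)//.
  apply/seteqP; split=> x /=; rewrite in_itv/= ler_pdivrMr// ltr_pdivlMr//.
    by move=> <-; rewrite floor_le floorD1_gt.
  by move=> h; apply: floor_def.
apply: (@measurable_fun_cvg _ _ _ _ (fun n p => f p.1 (q n p.2))) => //=.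
  move=> n _ B mB; rewrite setTI.
  rewrite (_ : _ @^-1` _ = \bigcup_(k in [set: int])
     ((f^~ (k%:~R / n.+1%:R) @^-1` B) `*` [set x : R | Num.floor (x * n.+1%:R) = k])); last first.
    apply/seteqP; split => [[w x]/= Bfx|[w x]/= [k _ [/= h1 h2]]].
      by exists (Num.floor (x * n.+1%:R)).
    by rewrite /q h2.
  apply: countable_bigcupT_measurable => [|k]; first exact: countableP.
  by apply: measurableX => //; rewrite -[X in measurable X]setTI; exact: mf.
move=> [w x] _ /=; apply: (continuous_cvg _ (cf w x)).
apply/cvgrPdist_le => /= e e0; near=> n.
rewrite /q.
have n0 : 0 < n.+1%:R :> R by [].
have h1 := @floor_le R (x * n.+1%:R).
have h2 := @floorD1_gt R (x * n.+1%:R).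
rewrite ger0_norm ?subr_ge0 ?ler_pdivrMr//.
have -> : x - (Num.floor (x * n.+1%:R))%:~R / n.+1%:R = (x * n.+1%:R - (Num.floor (x * n.+1%:R))%:~R) / n.+1%:R.
  by rewrite mulrBl mulfK// gt_eqF.
rewrite ler_pdivrMr//.
rewrite intrD in h2.
have : 1 <= e * n.+1%:R; last lra.
rewrite -ler_pdivrMl// mulr1.
near: n; exists (Num.truncn e^-1).+1 => //= n /= ; rewrite -(ler_nat R) => h.
rewrite (le_trans _ (le_trans h _)) ?ler_nat//.
by apply/ltW; exact: truncnS_gt.
Unshelve. all: by end_near. Qed.

(** * Parametric integrals and independence of the past *)

Section parametric_integrals.
Context {R : realType} d (Y : measurableType d) (P : probability Y R).

(** Dominated convergence with a constant bound. *)
Lemma continuous_Rintegral (f : R -> Y -> R) b :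
  (forall x, measurable_fun setT (f x)) -> (forall y, continuous (f^~ y)) ->
  (forall x y, `|f x y| <= b) -> continuous (fun x => \int[P]_y f x y).
Proof.
move=> mf cf fb x.
apply: (@continuity_under_integral _ _ _ P f setT measurableT (x - 1) (x + 1) _ _ (fun=> b)).
- by move=> z _; exact: (@bounded_integrable _ _ _ _ _ b).
- by apply: aeW => y _ z _; exact: cf.
- apply: (@bounded_integrable _ _ _ _ _ `|b|) => //; exact: measurable_cst.
- by move=> z _; apply: aeW => y _; exact: fb.
- by rewrite inE/= in_itv/=; lra.
Qed.

Context d' (T : measurableType d').

Lemma measurable_Rintegral (f : T -> Y -> R) b :
  measurable_fun setT (fun p : T * Y => f p.1 p.2) ->
  (forall w y, `|f w y| <= b) -> measurable_fun setT (fun w => \int[P]_y f w y).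
Proof.
move=> mf fb; have mf' : measurable_fun setT (fun p : T * Y => (f p.1 p.2 + b)%:E).
  apply/measurable_EFinP; apply: measurable_funD => //; exact: measurable_cst.
have := @measurable_fun_fubini_tonelli_F _ _ _ _ R P _ mf'.
rewrite /fubini_F => h.
have -> : (fun w => \int[P]_y f w y) = (fun w => fine (\int[P]_y ((f w y + b)%:E))%E - b).
  apply/funext => w; have mw : measurable_fun setT (f w).
    by have := measurableT_comp mf (pair1_measurable w).
  rewrite -[fine _]/(\int[P]_y (f w y + b)) RintegralD//.
  - by rewrite Rintegral_prob_cst addrK.
  - exact: (@bounded_integrable _ _ _ _ _ b).
  - by apply: (@bounded_integrable _ _ _ _ _ `|b|) => //; exact: measurable_cst.
apply: measurable_funB; last exact: measurable_cst.
apply: measurableT_comp => //; apply: h.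
by case=> w y /=; rewrite lee_fin -lerBlDr sub0r; have := fb w y; rewrite ler_norml => /andP[].
Qed.

End parametric_integrals.

Section independence.
Context {R : realType} d (Omega : measurableType d) (P : probability Omega R).
Context (U : nat -> {RV P >-> R}).

Definition past_cylinders (n : nat) : set (set Omega) :=
  [set A | exists (J : {fset nat}) (B : nat -> set R),
     [/\ forall i, measurable (B i), forall i, i \in J -> (i <= n)%N &
         A = \bigcap_(i in [set` J]) (U i @^-1` B i)]].

(** The same set as Omega, with the sigma-algebra generated by U_0, ..., U_n: being
measurable on [past n] expresses being determined by the first n + 1 variables. *)
Definition past (n : nat) := g_sigma_algebraType (past_cylinders n).

Lemma past_cylinders_measurable n : past_cylinders n `<=` measurable.
Proof.
move=> _ [J [B [mB _ ->]]]; apply: fin_bigcap_measurable.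
  exact: finite_fset.
by move=> i _; rewrite -[X in measurable X]setTI; exact: (measurable_funP _ measurableT).
Qed.

Lemma past_sub n (A : set Omega) : <<s past_cylinders n >> A -> measurable A.
Proof.
apply: smallest_sub; first exact: sigma_algebra_measurable.
exact: past_cylinders_measurable.
Qed.

Lemma measurable_id_past n : measurable_fun setT (idfun : Omega -> past n).
Proof. by move=> _ B mB; rewrite setTI; exact: (@past_sub n B). Qed.

Lemma measurable_of_past n (f : past n -> R) :
  measurable_fun setT f -> measurable_fun setT (f : Omega -> R).
Proof. by move=> mf; apply: (measurableT_comp mf (@measurable_id_past n)). Qed.

Lemma measurable_past n i : (i <= n)%N -> measurable_fun setT (U i : past n -> R).
Proof.
move=> lein _ B mB; rewrite setTI; apply: sub_sigma_algebra.
exists [fset i]%fset, (fun=> B); split => //.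
  by move=> j; rewrite inE => /eqP ->.
by apply/seteqP; split => [w Bw j /=|w /(_ i)/=]; rewrite inE; [move/eqP->|apply].
Qed.

Lemma measurable_id_past_mono m n : (m <= n)%N ->
  measurable_fun setT (idfun : past n -> past m).
Proof.
move=> lemn _ B mB; rewrite setTI.
have: past_cylinders m `<=` past_cylinders n.
  move=> A [J [D [mD leJ ->]]].
  by exists J, D; split => // i /leJ /leq_trans; apply.
move=> /(@sub_smallest2r _ (sigma_algebra setT) _ _) sub.
have : <<s past_cylinders m >> B by exact: mB.
exact: sub.
Qed.

Lemma measurable_past_mono m n (f : Omega -> R) : (m <= n)%N ->
  measurable_fun setT (f : past m -> R) -> measurable_fun setT (f : past n -> R).
Proof.
by move=> lemn mf; apply: (measurableT_comp mf (measurable_id_past_mono lemn)).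
Qed.

Hypothesis U_independent : mutually_independent U.

Lemma past_cylinders_setI n : setI_closed (past_cylinders n).
Proof.
move=> _ _ [J [B [mB leJ ->]]] [K [C [mC leK ->]]].
exists (J `|` K)%fset, (fun i => (if i \in J then B i else setT) `&`
  (if i \in K then C i else setT)); split.
- by move=> i; apply: measurableI; case: ifP => // _; exact: measurableT.
- by move=> i; rewrite inE => /orP[/leJ|/leK].
apply/seteqP; split => [w [Bw Cw] i /=|w h].
  by move=> _; split; case: ifP => // iin; [exact: Bw|exact: Cw].
split => i /= ii; have := h i; rewrite /= inE ii ?orbT => /(_ isT) []//.
Qed.

Lemma past_cylinders_setT n : past_cylinders n setT.
Proof.
exists fset0, (fun=> setT); split => //.
by apply/seteqP; split => // w _ i /=.
Qed.

(** Both sides are finite measures in A which agree, by independence, on the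
cylinders; these are stable under intersection and generate the past. *)
Lemma past_independent n (A : set Omega) (B : set R) :
  <<s past_cylinders n >> A -> measurable B ->
  P (A `&` U n.+1 @^-1` B) = (P A * P (U n.+1 @^-1` B))%E.
Proof.
move=> FA mB; have mUB : measurable (U n.+1 @^-1` B).
  by rewrite -[X in measurable X]setTI; exact: (measurable_funP _ measurableT).
have c0 : 0 <= fine (P (U n.+1 @^-1` B)) by rewrite fine_ge0.
rewrite -[P (U n.+1 @^-1` B)]fineK ?fin_num_measure// muleC.
rewrite -[LHS]/(mrestr P mUB A) -[RHS]/(mscale (NngNum c0) P A).
apply: (g_sigma_algebra_measure_unique (past_cylinders n) _ (fun=> setT)) FA => //.
- exact: past_cylinders_measurable.
- by move=> _; exact: past_cylinders_setT.
- by apply/seteqP; split => // w _; exists 0%N.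
- exact: past_cylinders_setI.
- move=> _ [J [D [mD leJ ->]]]; set E := \bigcap_(_ in _) _.
  rewrite -[LHS]/(P (E `&` U n.+1 @^-1` B)).
  rewrite -[RHS]/((fine (P (U n.+1 @^-1` B)))%:E * P E)%E {}/E fineK ?fin_num_measure//.
  pose D' i := if i == n.+1 then B else D i.
  have nJ : n.+1 \notin J by apply/negP => /leJ; rewrite ltnn.
  have mD' i : measurable (D' i) by rewrite /D'; case: ifP.
  have DD' i : i \in J -> D' i = D i.
    by move=> iJ; rewrite /D'; case: eqP => // ii; move: iJ nJ; rewrite ii => ->.
  have -> : \bigcap_(i in [set` J]) (U i @^-1` D i) `&` U n.+1 @^-1` B =
      \bigcap_(i in [set` (n.+1 |` J)%fset]) (U i @^-1` D' i).
    apply/seteqP; split => [w [h Bw] i /=|w h].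
      rewrite !inE => /orP[/eqP ->|iJ]; first by rewrite /D' eqxx.
      by rewrite DD'//; exact: h.
    split; last by have := h n.+1; rewrite /= !inE eqxx /D' eqxx; apply.
    by move=> i iJ; rewrite -DD'//; apply: h; rewrite /= !inE iJ orbT.
  rewrite U_independent// big_fsetU1//= {1}/D' eqxx; congr (_ * _)%E.
  rewrite U_independent//; apply: eq_big_seq => i iJ; by rewrite DD'.
- move=> _; rewrite -[X in (X < _)%E]/(P (setT `&` U n.+1 @^-1` B)).
  by rewrite setTI ltey_eq fin_num_measure.
Qed.

(** Freezing lemma: the joint law of the past and of U_(n+1) is a product, so
U_(n+1) may be integrated out with the past held fixed. *)
Lemma integral_new_variable n (Psi : past n * R -> R) :
  measurable_fun setT Psi -> (forall p, 0 <= Psi p) ->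
  (\int[P]_w (Psi (w, U n.+1 w))%:E =
   \int[P]_w \int[distribution P (U n.+1)]_u (Psi (w, u))%:E)%E.
Proof.
move=> mPsi Psi0.
pose idm : {mfun Omega >-> past n} := HB.pack (idfun : Omega -> past n)
  (isMeasurableFun.Build _ _ _ _ _ (@measurable_id_past n)).
have mpair : measurable_fun setT (fun w : Omega => (w : past n, U n.+1 w)).
  by apply/measurable_fun_pairP; split; [exact: measurable_id_past|exact: measurable_funP].
pose pairm : {mfun Omega >-> (past n * R)%type} := HB.pack
  (fun w : Omega => (w : past n, U n.+1 w))
  (isMeasurableFun.Build _ _ _ _ _ mpair).
have mPsiE : measurable_fun setT (EFin \o Psi) by exact/measurable_EFinP.
rewrite -[LHS]/(\int[P]_w ((EFin \o Psi) \o pairm) w)%E.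
rewrite -ge0_integral_distribution//.
transitivity (\int[distribution P idm \x distribution P (U n.+1)]_p (EFin \o Psi) p)%E.
  apply: eq_measure_integral => A mA _; apply/esym.
  apply: product_measure_unique => // C B mC mB.
  rewrite /distribution /pushforward /= -past_independent//.
rewrite fubini_tonelli1//.
rewrite ge0_integral_distribution//.
  by apply: measurable_fun_fubini_tonelli_F => // p; rewrite lee_fin.
by move=> w; apply: integral_ge0 => u _; rewrite lee_fin.
Qed.

End independence.

(** * Lipschitz functionals of a trajectory and their conditional means *)

(** K is a function of sequences of the length of L; it is bounded by b, and changing
entry i from x to x' moves it by at most L_i |cl x - cl x'|.  The map cl allows
one to measure the increments after a truncation, which makes them bounded.
The recursion follows the way in which the functional is evaluated, one time
step after the other. *)
Fixpoint seq_lipschitz {R : realType} (cl : R -> R) (b : R) (L : seq R) (K : seq R -> R) : Prop :=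
  if L is a :: L' then
    (forall x, seq_lipschitz cl b L' (fun y => K (x :: y))) /\
    (forall x x' y, size y = size L' ->
       `|K (x :: y) - K (x' :: y)| <= a * `|cl x - cl x'|)
  else `|K [::]| <= b.

Lemma seq_lipschitz_continuous {R : realType} (cl : R -> R) b a L K y :
  continuous cl -> seq_lipschitz cl b (a :: L) K -> size y = size L ->
  continuous (fun x => K (x :: y)).
Proof.
move=> ccl [_ Ka] yL x; apply/cvgrPdist_le => /= e e0.
have a0 : 0 < `|a| + 1 by rewrite ltr_pwDr.
have e1 : 0 < e / (`|a| + 1) by rewrite !divr_gt0.
move/cvgrPdist_le : (ccl x) => /(_ _ e1) h1.
near=> z; apply: (le_trans (Ka _ _ _ yL)).
have : `|cl x - cl z| <= e / (`|a| + 1) by near: z.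
rewrite ler_pdivlMr// => /(le_trans _); apply.
by rewrite mulrC ler_wpM2l// (le_trans (ler_norm _))// lerDl.
Unshelve. all: by end_near. Qed.

Lemma measurable_seq_lipschitz {R : realType} d (T : measurableType d) (cl : R -> R) b L
    (V : nat -> T -> R) (K : T -> seq R -> R) j :
  continuous cl -> (forall i, measurable_fun setT (V i)) ->
  (forall w, seq_lipschitz cl b L (K w)) ->
  (forall y, size y = size L -> measurable_fun setT (K^~ y)) ->
  measurable_fun setT (fun w => K w [seq V i w | i <- iota j (size L)]).
Proof.
move=> ccl mV; elim: L K j => [|a L IH] K j nK mK; first exact: mK.
apply: (IH (fun w y => K w (V j w :: y))).
  by move=> w; have [h _] := nK w; exact: h.
move=> y yL.
have m2 : measurable_fun setT (fun p : T * R => K p.1 (p.2 :: y)).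
  apply: (caratheodory_measurable_fun (f := fun w x => K w (x :: y))).
    by move=> x; apply: mK; rewrite /= yL.
  by move=> w; exact: seq_lipschitz_continuous (nK w) yL.
apply: (measurableT_comp m2 (g := fun w => (w, V j w))).
by apply: measurable_fun_pair.
Qed.

Section backward_expectation.
Context {R : realType} (nu : probability R R) (F : R -> R -> R).
Context (cl : R -> R) (width : R).
Hypotheses (F_measurable : forall x, measurable_fun setT (F x))
  (F_continuous : forall u, continuous (F^~ u)).
Hypotheses (cl_continuous : continuous cl)
  (cl_width : forall x y, `|cl x - cl y| <= width).

Definition transition (G : R -> R) (x : R) : R := \int[nu]_u G (F x u).

(** The mean of K (X_1, ..., X_m) for the trajectory that starts at X_0 = x: the next
position x1 is drawn, then it is both recorded in K and used as the new starting
point. *)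
Fixpoint path_mean (m : nat) (K : seq R -> R) (x : R) : R :=
  if m is m'.+1 then
    transition (fun x1 => path_mean m' (fun y => K (x1 :: y)) x1) x
  else K [::].

Definition continuous_bounded (G : R -> R) (b : R) :=
  continuous G /\ forall x, `|G x| <= b.

Lemma continuous_measurable (G : R -> R) : continuous G -> measurable_fun setT G.
Proof. exact: continuous_measurable_fun. Qed.

Lemma measurable_after_step (G : R -> R) x : continuous G -> measurable_fun setT (fun u => G (F x u)).
Proof. by move=> cG; apply: measurableT_comp => //; exact: continuous_measurable. Qed.

Lemma transition_continuous_bounded G b :
  continuous_bounded G b -> continuous_bounded (transition G) b.
Proof.
move=> [cG Gb]; split.
  apply: (@continuous_Rintegral _ _ _ _ _ b) => //.
  - by move=> x; exact: measurable_after_step.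
  - by move=> u x; apply: continuous_comp; [exact: F_continuous|exact: cG].
by move=> x; apply: Rintegral_prob_le => //; exact: measurable_after_step.
Qed.

Lemma transition_dist G G' b b' c :
  continuous_bounded G b -> continuous_bounded G' b' ->
  (forall x, `|G x - G' x| <= c) ->
  forall x, `|transition G x - transition G' x| <= c.
Proof.
move=> [cG Gb] [cG' Gb'] GG' x.
by apply: (@Rintegral_prob_dist _ _ _ _ _ _ b b') => //; exact: measurable_after_step.
Qed.

Lemma iter_transition_continuous_bounded G b k :
  continuous_bounded G b -> continuous_bounded (iter k transition G) b.
Proof.
by move=> Gb; elim: k => //= k; exact: transition_continuous_bounded.
Qed.

Lemma iter_transitionD G G' b b' k :
  continuous_bounded G b -> continuous_bounded G' b' ->
  iter k transition (fun x => G x + G' x) =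
  (fun x => iter k transition G x + iter k transition G' x).
Proof.
move=> Gb Gb'; elim: k => // k /= ->; apply/funext => x.
have [c1 b1] := @iter_transition_continuous_bounded G b k Gb.
have [c2 b2] := @iter_transition_continuous_bounded G' b' k Gb'.
rewrite /transition RintegralD//.
  by apply: (@bounded_integrable _ _ _ _ _ b) => //; exact: measurable_after_step.
by apply: (@bounded_integrable _ _ _ _ _ b') => //; exact: measurable_after_step.
Qed.

(** Continuity of the mean in the starting point requires, one step earlier,
continuity along the diagonal where the starting point is also an argument of K;
this uses that the mean is nonexpansive in K.  The three properties are
therefore proved together. *)
Definition path_mean_regular b L := forall K, seq_lipschitz cl b L K ->
  continuous_bounded (path_mean (size L) K) b /\
  forall K' c, seq_lipschitz cl b L K' ->
    (forall y, size y = size L -> `|K y - K' y| <= c) ->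
    forall x, `|path_mean (size L) K x - path_mean (size L) K' x| <= c.

Lemma path_mean_regular_diag b a L K : path_mean_regular b L -> seq_lipschitz cl b (a :: L) K ->
  continuous_bounded (fun x => path_mean (size L) (fun y => K (x :: y)) x) b.
Proof.
move=> reg [Kx Ka]; split; last by move=> x; have [[_ h] _] := reg _ (Kx x); exact: h.
move=> x; apply/cvgrPdist_le => /= e e0.
have [[cx _] dx] := reg _ (Kx x).
have a0 : 0 < `|a| + 1 by rewrite ltr_pwDr.
have e1 : 0 < e / 2 / (`|a| + 1) by rewrite !divr_gt0.
have e2 : 0 < e / 2 by rewrite divr_gt0.
move/cvgrPdist_le : (@cl_continuous x) => /(_ _ e1) h1.
move/cvgrPdist_le : (cx x) => /(_ _ e2) h2.
near=> z.
have := dx _ (`|a| * `|cl x - cl z|) (Kx z).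
move=> /(_ _ z) => h.
rewrite -(subrKA (path_mean (size L) (fun y => K (x :: y)) z)) (splitr e).
rewrite (le_trans (ler_normD _ _))// lerD//; first by near: z.
rewrite (le_trans (h _))//.
  by move=> y /(Ka x z) /le_trans; apply; rewrite ler_wpM2r// ler_norm.
have : `|cl x - cl z| <= e / 2 / (`|a| + 1) by near: z.
rewrite ler_pdivlMr// => /(le_trans _); apply.
by rewrite mulrC ler_wpM2l// lerDl.
Unshelve. all: by end_near. Qed.

Lemma path_mean_regularP b L : path_mean_regular b L.
Proof.
elim: L => [|a L IH] K.
  move=> /= Kb; split; first by split => // x; exact: cvg_cst.
  by move=> K' c _ KK' x; exact: KK'.
move=> nK; split.
  exact: (transition_continuous_bounded (path_mean_regular_diag IH nK)).
move=> K' c nK' KK'; apply: (@transition_dist _ _ b b).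
- exact: path_mean_regular_diag IH nK.
- exact: path_mean_regular_diag IH nK'.
case: nK nK' => [Kx Ka] [Kx' _] x; have [_ h] := IH _ (Kx x).
by apply: h; [exact: Kx'|move=> y yL; apply: KK'; rewrite /= yL].
Qed.

Lemma path_mean_continuous_bounded b L K : seq_lipschitz cl b L K -> continuous_bounded (path_mean (size L) K) b.
Proof. by move=> /path_mean_regularP[]. Qed.

Lemma path_mean_diag b a L K : seq_lipschitz cl b (a :: L) K ->
  continuous_bounded (fun x => path_mean (size L) (fun y => K (x :: y)) x) b.
Proof. by apply: path_mean_regular_diag; exact: path_mean_regularP. Qed.

Lemma measurable_joint_map : measurable_fun setT (fun p : R * R => F p.1 p.2).
Proof.
have := @caratheodory_measurable_fun R _ R (fun u x => F x u) F_measurable F_continuous.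
by move=> h; apply: (measurableT_comp h (@measurable_swap _ _ _ _)).
Qed.

Lemma measurable_path_mean d (T : measurableType d) b L (K : T -> seq R -> R) x :
  (forall w, seq_lipschitz cl b L (K w)) ->
  (forall y, size y = size L -> measurable_fun setT (K^~ y)) ->
  measurable_fun setT (fun w => path_mean (size L) (K w) x).
Proof.
elim: L K x => [|a L IH] K x nK mK; first exact: mK.
apply: (@measurable_Rintegral _ _ _ _ _ _ _ b).
  pose phi w x1 := path_mean (size L) (fun y => K w (x1 :: y)) x1.
  have : measurable_fun setT (fun p : T * R => phi p.1 p.2).
    apply: caratheodory_measurable_fun.
      move=> z; apply: (IH (fun w y => K w (z :: y))) => [w|y yL].
        by have [h _] := nK w; exact: h.
      by apply: mK; rewrite /= yL.
    by move=> w; have [c _] := path_mean_diag (nK w); exact: c.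
  move=> mphi; apply: (measurableT_comp mphi (g := fun p : T * R => (p.1, F x p.2))).
  by apply: measurable_fun_pair; [exact: measurable_fst|exact: (measurableT_comp (@F_measurable x) measurable_snd)].
by move=> w u; have [_ h] := path_mean_diag (nK w); exact: h.
Qed.

(** The oscillation of the conditional mean at a given time, up to a factor: a change
of position at time j is felt at time j + i with weight rho^i. *)
Fixpoint discounted_sum (rho : R) (L : seq R) : R :=
  if L is a :: L' then a + rho * discounted_sum rho L' else 0.

(** The sum of the squares of the discounted sums over all suffixes of L, that is,
over all times. *)
Fixpoint discounted_squares (rho : R) (L : seq R) : R :=
  if L is a :: L' then discounted_sum rho L ^+ 2 + discounted_squares rho L' else 0.

Context (C rho : R).
Hypotheses (C_ge0 : 0 <= C) (rho_ge0 : 0 <= rho) (rho_lt1 : rho < 1).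
Hypothesis mixing : forall k G b, continuous_bounded G b -> forall x x',
  `|iter k.+1 transition G x - iter k.+1 transition G x'| <= C * rho ^+ k.+1 * b.

Lemma discounted_sum_ge0 L : all (fun a => 0 <= a) L -> 0 <= discounted_sum rho L.
Proof.
by elim: L => //= a L IH /andP[a0 /IH L0]; rewrite addr_ge0// mulr_ge0.
Qed.

(** Convexity of the square gives
(a + rho s)^2 <= a^2 / (1 - rho) + rho s^2; the second term of the left-hand side
below is the potential that makes the induction on L close. *)
Lemma discounted_squares_le L :
  discounted_squares rho L + discounted_sum rho L ^+ 2 * (rho / (1 - rho)) <=
  (\sum_(a <- L) a ^+ 2) / (1 - rho) ^+ 2.
Proof.
have r1 : 0 < 1 - rho by rewrite subr_gt0.
elim: L => [|a L IH]; first by rewrite big_nil /= mul0r expr0n/= mul0r addr0.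
rewrite big_cons [X in _ <= X]mulrDl /=.
set s := discounted_sum rho L in IH *; set v := discounted_squares rho L in IH *.
apply: le_trans (_ : _ <= a ^+ 2 / (1 - rho) ^+ 2 + (v + s ^+ 2 * (rho / (1 - rho)))) _; last by rewrite lerD2l.
rewrite -subr_ge0.
have -> : a ^+ 2 / (1 - rho) ^+ 2 + (v + s ^+ 2 * (rho / (1 - rho))) -
  ((a + rho * s) ^+ 2 + v + (a + rho * s) ^+ 2 * (rho / (1 - rho))) =
  rho / (1 - rho) ^+ 2 * (a - (1 - rho) * s) ^+ 2.
  by field; rewrite gt_eqF.
by rewrite mulr_ge0 ?sqr_ge0// divr_ge0// sqr_ge0.
Qed.

(** Replace the first argument x1 of K by a fixed point.  The error is a function of x1
bounded by a * width, to which mixing applies; what remains depends on x1 only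
through the starting point, so it is a mean of a shorter functional after one
more transition.  The induction is thus over L, for all k at once. *)
Lemma iter_path_mean_oscillation b L K k x x' :
  seq_lipschitz cl b L K -> all (fun a => 0 <= a) L ->
  `|iter k transition (path_mean (size L) K) x - iter k transition (path_mean (size L) K) x'|
    <= C * width * rho ^+ k.+1 * discounted_sum rho L.
Proof.
elim: L K k => [|a L IH] K k nK L0.
  have -> : iter k transition (path_mean (size ([::] : seq R)) K) = (fun=> K [::]).
    elim: k => // k /= ->; apply/funext => z.
    by rewrite /transition Rintegral_prob_cst.
  by rewrite subrr normr0 mulr0.
case/andP: (L0) => a0 /= L1; case: (nK) => Kx Ka.
pose phi x1 := path_mean (size L) (fun y => K (x1 :: y)) x1.
pose psi := path_mean (size L) (fun y => K (0 :: y)).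
have [cphi bphi] : continuous_bounded phi b := path_mean_diag nK.
have cbpsi : continuous_bounded psi b := path_mean_continuous_bounded (Kx 0).
have [cpsi bpsi] := cbpsi.
have cbd : continuous_bounded (fun z => phi z - psi z) (a * width).
  split; first by move=> z; apply: continuousB; [exact: cphi|exact: cpsi].
  move=> z; have [_ h] := path_mean_regularP (Kx z); apply: h => [|y yL]; first exact: Kx.
  by apply: (le_trans (Ka z 0 y yL)); rewrite ler_wpM2l.
have -> : transition phi = transition (fun z => (phi z - psi z) + psi z).
  by congr transition; apply/funext => z; rewrite subrK.
rewrite -!iterSr !(iter_transitionD _ cbd cbpsi) opprD addrACA.
rewrite (le_trans (ler_normD _ _))//.
have -> : C * width * rho ^+ k.+1 * (a + rho * discounted_sum rho L) =
   C * rho ^+ k.+1 * (a * width) + C * width * rho ^+ k.+2 * discounted_sum rho L.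
  by rewrite !exprS; ring.
rewrite lerD//.
  exact: (@mixing k _ _ cbd).
exact: (IH (fun y => K (0 :: y)) k.+1 (Kx 0) L1).
Qed.

(** The position x plays two roles: as an argument of K it contributes a * width, as a
starting point it contributes the bound of [iter_path_mean_oscillation]. *)
Lemma path_mean_diag_oscillation b a L K x x' :
  seq_lipschitz cl b (a :: L) K -> all (fun a => 0 <= a) (a :: L) ->
  `|path_mean (size L) (fun y => K (x :: y)) x - path_mean (size L) (fun y => K (x' :: y)) x'|
    <= width * (1 + C) * discounted_sum rho (a :: L).
Proof.
move=> [Kx Ka] /andP[a0 L0].
have w0 : 0 <= width by apply: le_trans (cl_width 0 0).
have s0 := discounted_sum_ge0 L0.
rewrite -(subrKA (path_mean (size L) (fun y => K (x' :: y)) x)) (le_trans (ler_normD _ _))//=.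
have h1 : `|path_mean (size L) (fun y => K (x :: y)) x - path_mean (size L) (fun y => K (x' :: y)) x|
     <= a * width.
  have [_ h] := path_mean_regularP (Kx x); apply: h => [|y yL]; first exact: Kx.
  by apply: (le_trans (Ka _ _ y yL)); rewrite ler_wpM2l.
have := @iter_path_mean_oscillation _ _ _ 0 x x' (Kx x') L0; rewrite /= expr1 => h2.
apply: (le_trans (lerD h1 h2)).
rewrite -subr_ge0.
have -> : width * (1 + C) * (a + rho * discounted_sum rho L) - (a * width + C * width * rho * discounted_sum rho L)
  = width * rho * discounted_sum rho L + width * C * a by ring.
by rewrite addr_ge0// !mulr_ge0.
Qed.

End backward_expectation.

(** * Concentration for iterated random maps *)

Section random_iteration.
Context {R : realType} d (Omega : measurableType d) (P : probability Omega R).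
Context (U : nat -> {RV P >-> R}) (nu : probability R R) (F : R -> R -> R).
Context (X : nat -> Omega -> R) (cl : R -> R) (width : R).
Hypotheses (U_independent : mutually_independent U)
  (U_law : forall n (A : set R), measurable A -> distribution P (U n.+1) A = nu A).
Hypotheses (F_measurable : forall x, measurable_fun setT (F x))
  (F_continuous : forall u, continuous (F^~ u)).
Hypotheses (X_init : forall w, X 0 w = U 0 w)
  (X_step : forall n w, X n.+1 w = F (X n w) (U n.+1 w)).
Hypotheses (cl_continuous : continuous cl)
  (cl_width : forall x y, `|cl x - cl y| <= width).

Let Q := transition nu F.

Lemma measurable_X n : measurable_fun setT (X n : past U n -> R).
Proof.
elim: n => [|n IH].
  rewrite (_ : X 0%N = U 0%N); last exact/funext.
  exact: measurable_past.
rewrite (_ : X n.+1 = fun w => F (X n w) (U n.+1 w)); last exact/funext.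
have := measurable_joint_map F_measurable F_continuous => mF.
apply: (measurableT_comp mF (g := fun w : past U n.+1 => (X n w, U n.+1 w))).
apply: measurable_fun_pair; last exact: measurable_past.
exact: (measurable_past_mono (leqnSn n) IH).
Qed.

Lemma measurable_joint n (phi : past U n -> R -> R) :
  (forall x, measurable_fun setT (phi^~ x)) -> (forall w, continuous (phi w)) ->
  measurable_fun setT (fun p : past U n * R => phi p.1 (F (X n p.1) p.2)).
Proof.
move=> mphi cphi; have := caratheodory_measurable_fun mphi cphi => m2.
apply: (measurableT_comp m2 (g := fun p : past U n * R => (p.1, F (X n p.1) p.2))).
apply: measurable_fun_pair; first exact: measurable_fst.
have := measurable_joint_map F_measurable F_continuous => mF.
apply: (measurableT_comp mF (g := fun p : past U n * R => (X n p.1, p.2))).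
apply: measurable_fun_pair; last exact: measurable_snd.
exact: measurableT_comp (@measurable_X n) measurable_fst.
Qed.

Lemma measurable_next n (phi : past U n -> R -> R) :
  (forall x, measurable_fun setT (phi^~ x)) -> (forall w, continuous (phi w)) ->
  measurable_fun setT (fun w : past U n.+1 => phi w (X n.+1 w)).
Proof.
move=> mphi cphi; have m2 := measurable_joint mphi cphi.
rewrite (_ : (fun w => _) = fun w : past U n.+1 => phi w (F (X n w) (U n.+1 w))); last first.
  by apply/funext => w; rewrite X_step.
apply: (measurableT_comp m2 (g := fun w : past U n.+1 => (w : past U n, U n.+1 w))).
apply: measurable_fun_pair; last exact: measurable_past.
exact: measurable_id_past_mono.
Qed.

(** The Markov property.  [integral_new_variable] is stated for nonnegative functions, hence
the shift by b. *)
Lemma expectation_next n (phi : past U n -> R -> R) b :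
  (forall x, measurable_fun setT (phi^~ x)) -> (forall w, continuous (phi w)) ->
  (forall w x, `|phi w x| <= b) ->
  \int[P]_w phi w (X n.+1 w) = \int[P]_w Q (phi w) (X n w).
Proof.
move=> mphi cphi phib.
have m2 := measurable_joint mphi cphi.
have mX : measurable_fun setT (fun w : Omega => phi w (X n.+1 w)).
  exact: (measurable_of_past (measurable_next mphi cphi)).
have mQ : measurable_fun setT (fun w : past U n => Q (phi w) (X n w)).
  by apply: (@measurable_Rintegral _ _ _ _ _ _ _ b) => // w u; exact: phib.
have mQ' : measurable_fun setT (fun w : Omega => Q (phi w) (X n w)).
  exact: measurable_of_past mQ.
have mu w : measurable_fun setT (fun u => phi w (F (X n w) u)).
  exact: (measurableT_comp m2 (pair1_measurable w)).
have cstb : P.-integrable setT (EFin \o (fun _ : Omega => b)).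
  by apply: (@bounded_integrable _ _ _ _ _ `|b|) => //; exact: measurable_cst.
suff : \int[P]_w (phi w (X n.+1 w) + b) = \int[P]_w (Q (phi w) (X n w) + b).
  rewrite !RintegralD//.
  - by move/addIr.
  - apply: (@bounded_integrable _ _ _ _ _ b) => // w.
    by apply: Rintegral_prob_le.
  - exact: (@bounded_integrable _ _ _ _ _ b).
have := @integral_new_variable _ _ _ _ _ U_independent n
  (fun p : past U n * R => phi p.1 (F (X n p.1) p.2) + b) _ _.
move=> /= h; rewrite /Rintegral; congr fine.
under eq_integral do rewrite X_step.
rewrite h.
- apply: eq_integral => w _.
  transitivity (\int[nu]_u (phi w (F (X n w) u) + b)%:E)%E.
    by apply: eq_measure_integral => A mA _; exact: U_law.
  rewrite -[LHS]fineK.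
    congr EFin; rewrite -[LHS]/(\int[nu]_u (phi w (F (X n w) u) + b)) RintegralD//.
    + by rewrite Rintegral_prob_cst.
    + exact: (@bounded_integrable _ _ _ _ _ b).
    + by apply: (@bounded_integrable _ _ _ _ _ `|b|) => //; exact: measurable_cst.
  apply: integrable_fin_num => //; apply: (@bounded_integrable _ _ _ _ _ (b + `|b|)) => //.
    by apply: measurable_funD => //; exact: measurable_cst.
  by move=> u; rewrite (le_trans (ler_normD _ _))// lerD2r.
- by apply: measurable_funD => //; exact: measurable_cst.
- move=> p; rewrite -lerBlDr sub0r.
  by have := phib p.1 (F (X n p.1) p.2); rewrite ler_norml => /andP[].
Qed.

Definition states j m (w : Omega) := [seq X i w | i <- iota j.+1 m].

Lemma seq_lipschitz_next n a L b (K : Omega -> seq R -> R) w :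
  seq_lipschitz cl b (a :: L) (K w) -> seq_lipschitz cl b L (fun y => K w (X n.+1 w :: y)).
Proof. by move=> [h _]; exact: h. Qed.

Lemma measurable_next_section n a L b (K : past U n -> seq R -> R) y :
  (forall w, seq_lipschitz cl b (a :: L) (K w)) -> 
  (forall y, size y = (size L).+1 -> measurable_fun setT (K^~ y)) ->
  size y = size L ->
  measurable_fun setT (fun w : past U n.+1 => K w (X n.+1 w :: y)).
Proof.
move=> nK mK yL.
apply: (measurable_next (phi := fun w x => K w (x :: y))) => [x|w].
  by apply: mK; rewrite /= yL.
exact: seq_lipschitz_continuous (nK w) yL.
Qed.

Section states.
Context (b : R).

Let phi (L : seq R) (K : Omega -> seq R -> R) w x :=
  path_mean nu F (size L) (fun y => K w (x :: y)) x.

Lemma measurable_next_mean n a L (K : past U n -> seq R -> R) x :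
  (forall w, seq_lipschitz cl b (a :: L) (K w)) ->
  (forall y, size y = (size L).+1 -> measurable_fun setT (K^~ y)) ->
  measurable_fun setT (fun w : past U n => phi L K w x).
Proof.
move=> nK mK.
apply: (@measurable_path_mean _ nu F cl F_measurable F_continuous
  cl_continuous _ _ b _ (fun w y => K w (x :: y))).
  by move=> w; have [h _] := nK w; exact: h.
by move=> y yL; apply: mK; rewrite /= yL.
Qed.

Lemma next_mean_continuous_bounded a L K w : seq_lipschitz cl b (a :: L) (K w) -> continuous_bounded (phi L K w) b.
Proof. exact: (path_mean_diag nu F_measurable F_continuous cl_continuous). Qed.

(** In these inductions K may depend on the past up to time j, so that the positions
already visited are absorbed into K. *)
Lemma expectation_states L j (K : past U j -> seq R -> R) :
  (forall w, seq_lipschitz cl b L (K w)) ->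
  (forall y, size y = size L -> measurable_fun setT (K^~ y)) ->
  \int[P]_w K w (states j (size L) w) = \int[P]_w path_mean nu F (size L) (K w) (X j w).
Proof.
elim: L j K => [//|a L IH] j K nK mK.
transitivity (\int[P]_w phi L K w (X j.+1 w)).
  apply: (IH j.+1 (fun w y => K w (X j.+1 w :: y))).
    by move=> w; exact: seq_lipschitz_next (nK w).
  by move=> y yL; apply: measurable_next_section yL.
apply: (@expectation_next _ _ b).
- by move=> x; apply: measurable_next_mean nK mK.
- by move=> w; have [c _] := next_mean_continuous_bounded (nK w).
- by move=> w x; have [_ h] := next_mean_continuous_bounded (nK w); exact: h.
Qed.

Context (C rho : R).
Hypotheses (C_ge0 : 0 <= C) (rho_ge0 : 0 <= rho) (rho_lt1 : rho < 1).
Hypothesis mixing : forall k G b, continuous_bounded G b -> forall x x',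
  `|iter k.+1 (transition nu F) G x - iter k.+1 (transition nu F) G x'|
    <= C * rho ^+ k.+1 * b.

Lemma measurable_expRM d' (T : measurableType d') (f : T -> R) l :
  measurable_fun setT f -> measurable_fun setT (fun x => expR (l * f x)).
Proof.
by move=> mf; apply: measurableT_comp => //; apply: measurable_funM => //; exact: measurable_cst.
Qed.

Lemma expRM_bounded (x l : R) : `|x| <= b -> `|expR (l * x)| <= expR (`|l| * b).
Proof.
move=> xb; rewrite ger0_norm ?expR_ge0// ler_expR (le_trans (ler_norm _))//.
by rewrite normrM ler_wpM2l.
Qed.

(** One step: conditionally on the past up to time j, the mean of the remaining
functional depends on the new variable only, and Hoeffding's lemma applies with
the oscillation of [path_mean_diag_oscillation]. *)
Lemma exp_moment_states L j (K : past U j -> seq R -> R) l :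
  (forall w, seq_lipschitz cl b L (K w)) ->
  (forall y, size y = size L -> measurable_fun setT (K^~ y)) ->
  all (fun a => 0 <= a) L ->
  \int[P]_w expR (l * K w (states j (size L) w)) <=
  expR (2 * (l * (width * (1 + C))) ^+ 2 * discounted_squares rho L) *
  \int[P]_w expR (l * path_mean nu F (size L) (K w) (X j w)).
Proof.
elim: L j K => [|a L IH] j K nK mK.
  by move=> _ /=; rewrite mulr0 expR0 mul1r.
move=> /[dup] aL0 /andP[a0 L0].
have mphi x : measurable_fun setT (fun w : past U j => phi L K w x).
  exact: measurable_next_mean nK mK.
have cphi w : continuous (phi L K w) by have [c _] := next_mean_continuous_bounded (nK w).
have phib w x : `|phi L K w x| <= b by have [_ h] := next_mean_continuous_bounded (nK w).
have step : \int[P]_w expR (l * phi L K w (X j.+1 w)) =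
    \int[P]_w Q (fun x => expR (l * phi L K w x)) (X j w).
  apply: (@expectation_next _ (fun w x => expR (l * phi L K w x)) (expR (`|l| * b))).
  - by move=> x; exact: measurable_expRM.
  - move=> w x; apply: (@continuous_comp _ _ _ (fun x => l * phi L K w x)).
      by apply: continuousM; [exact: cst_continuous|exact: cphi].
    exact: continuous_expR.
  - by move=> w x; exact: expRM_bounded.
have IH' := IH j.+1 (fun w y => K w (X j.+1 w :: y)) _ _ L0.
apply: (le_trans (IH' _ _)).
- by move=> w; exact: seq_lipschitz_next (nK w).
- by move=> y yL; apply: measurable_next_section yL.
rewrite -[X in _ * X <= _]/(\int[P]_w expR (l * phi L K w (X j.+1 w))) step.
rewrite [discounted_squares rho (a :: L)]/=.
rewrite -[a + rho * discounted_sum rho L]/(discounted_sum rho (a :: L)) [(discounted_sum rho _ ^+ 2 + _)]addrC.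
rewrite [X in _ <= expR X * _]mulrDr expRD -[leRHS]mulrA ler_wpM2l ?expR_ge0//.
have m2 : measurable_fun setT (fun p : past U j * R => phi L K p.1 (F (X j p.1) p.2)).
  exact: measurable_joint.
have mQ : measurable_fun setT (fun w : past U j => Q (phi L K w) (X j w)).
  by apply: (@measurable_Rintegral _ _ _ _ _ _ _ b).
have mQe : measurable_fun setT (fun w : past U j => Q (fun x => expR (l * phi L K w x)) (X j w)).
  apply: (@measurable_Rintegral _ _ _ _ _ _ _ (expR (`|l| * b))).
    exact: measurable_expRM.
  by move=> w u; exact: expRM_bounded.
have mu (w : past U j) : measurable_fun setT (fun u => phi L K w (F (X j w) u)).
  exact: (measurableT_comp m2 (pair1_measurable w)).
have iE : P.-integrable setT (EFin \o fun w => expR (l * Q (phi L K w) (X j w))).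
  apply: (@bounded_integrable _ _ _ _ _ (expR (`|l| * b))).
    by apply: measurable_expRM; exact: measurable_of_past mQ.
  by move=> w; apply: expRM_bounded; apply: Rintegral_prob_le.
rewrite -RintegralZl//; apply: le_Rintegral => //.
- apply: (@bounded_integrable _ _ _ _ _ (expR (`|l| * b))).
    exact: measurable_of_past mQe.
  move=> w; apply: Rintegral_prob_le; first exact: measurable_expRM.
  by move=> u; exact: expRM_bounded.
- have := integrableZl measurableT (expR (2 * (l * (width * (1 + C))) ^+ 2 * (discounted_sum rho (a :: L)) ^+ 2)) iE.
  by apply: eq_integrable.
move=> w _; rewrite -expRD.
have osc u u' : `|phi L K w (F (X j w) u) - phi L K w (F (X j w) u')| <=
    width * (1 + C) * discounted_sum rho (a :: L).
  exact: (path_mean_diag_oscillation F_measurable F_continuous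
    cl_continuous cl_width C_ge0 rho_ge0 mixing _ _ (nK w) aL0).
have := @hoeffding _ _ _ nu _ b _ l (mu w) (fun u => phib w _) osc.
move=> /le_trans; apply; rewrite addrC ler_expR lerD2r.
by rewrite !exprMn !mulrA.
Qed.

(** [exp_moment_states] leaves the exponential moment of the mean as a function of X_0, which
is treated with Hoeffding's lemma once more; its oscillation is paid for by the
second term of [discounted_squares_le]. *)
Theorem random_iteration_concentration L (K : seq R -> R) l :
  seq_lipschitz cl b L K -> all (fun a => 0 <= a) L ->
  \int[P]_w expR (l * K (states 0 (size L) w)) <=
  expR (l * \int[P]_w K (states 0 (size L) w) +
    2 * (l * (width * (1 + C))) ^+ 2 * ((\sum_(a <- L) a ^+ 2) / (1 - rho) ^+ 2)).
Proof.
move=> nK L0; rewrite (expectation_states (j := 0) (K := fun=> K))//.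
apply: (le_trans (exp_moment_states (j := 0) (K := fun=> K) _ _ _ L0)) => //.
have [cE bE] := path_mean_continuous_bounded nu F_measurable F_continuous cl_continuous nK.
have mX0 : measurable_fun setT (X 0%N) by exact: (measurable_of_past (@measurable_X 0%N)).
have mE : measurable_fun setT (fun w => path_mean nu F (size L) K (X 0%N w)).
  by apply: measurableT_comp => //; exact: continuous_measurable.
have osc w w' := @iter_path_mean_oscillation _ nu F cl width F_measurable F_continuous
  cl_continuous cl_width C rho mixing b L K 0 (X 0%N w) (X 0%N w') nK L0.
rewrite /= in osc.
have := @hoeffding _ _ _ P _ b _ l mE (fun w => bE _) osc.
move=> /(ler_wpM2l (expR_ge0 (2 * (l * (width * (1 + C))) ^+ 2 * discounted_squares rho L))).
move=> /le_trans; apply; rewrite -expRD ler_expR addrCA.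
rewrite lerD2l expr1.
have r1 : 0 < 1 - rho by rewrite subr_gt0.
apply: le_trans (ler_wpM2l _ (discounted_squares_le rho_ge0 rho_lt1 L)); last first.
  by rewrite mulr_ge0// sqr_ge0.
rewrite [leRHS]mulrDr lerD2l -[leRHS]mulrA ler_pM2l// !exprMn.
rewrite -subr_ge0.
have -> : l ^+ 2 * (width ^+ 2 * (1 + C) ^+ 2) * (discounted_sum rho L ^+ 2 * (rho / (1 - rho))) -
   l ^+ 2 * (C ^+ 2 * width ^+ 2 * rho ^+ 2 * discounted_sum rho L ^+ 2) =
   l ^+ 2 * width ^+ 2 * discounted_sum rho L ^+ 2 * (rho * ((1 + C) ^+ 2 / (1 - rho) - C ^+ 2 * rho)).
  by field; rewrite gt_eqF.
apply: mulr_ge0; first by rewrite -!exprMn sqr_ge0.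
apply: mulr_ge0 => //; rewrite subr_ge0 ler_pdivlMr//.
apply: (@le_trans _ _ (C ^+ 2)); last first.
  by rewrite lerXn2r ?nnegrE// ?addr_ge0// lerDr.
rewrite -mulrA -[leRHS]mulr1 ler_wpM2l ?sqr_ge0//.
by apply: mulr_ile1; rewrite ?gerBl// ltW.
Qed.
End states.

End random_iteration.

(** * Clamping and integration on an interval *)

Definition clamp {R : realType} (l r x : R) : R := Num.max l (Num.min r x).

Section clamp.
Context {R : realType} (l r : R).
Hypothesis lr : l <= r.

Lemma clamp_in x : clamp l r x \in `[l, r].
Proof. by rewrite in_itv/= /clamp le_max lexx/= ge_max lr ge_min lexx. Qed.

Lemma clamp_id x : x \in `[l, r] -> clamp l r x = x.
Proof.
by rewrite in_itv/= => /andP[lx xr]; rewrite /clamp min_r// max_r.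
Qed.

Lemma clamp_dist x y : `|clamp l r x - clamp l r y| <= `|x - y|.
Proof.
have h1 := ler_norm (x - y); have h2 := ler_norm (y - x); have h3 := lr.
rewrite (distrC y x) in h2; rewrite ler_norml /clamp; apply/andP.
by case: (leP r x) => ?; case: (leP r y) => ?; rewrite ?(max_r lr);
  case: (leP l x) => ?; case: (leP l y) => ?; split; lra.
Qed.

Lemma clamp_width x y : `|clamp l r x - clamp l r y| <= r - l.
Proof.
have := clamp_in x; have := clamp_in y; rewrite !in_itv/= => /andP[? ?] /andP[? ?].
by rewrite ler_norml; apply/andP; split; lra.
Qed.

Lemma continuous_clamp : continuous (clamp l r).
Proof.
move=> x; apply/cvgrPdist_le => /= e e0; near=> z.
by apply: (le_trans (clamp_dist _ _)); near: z; apply: cvgr_dist_le.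
Unshelve. all: by end_near. Qed.

Lemma continuous_comp_clamp (f : R -> R) :
  {within `[l, r], continuous f} -> continuous (f \o clamp l r).
Proof.
move=> /subspace_continuousP cf y.
have := cf (clamp l r y) (clamp_in y); apply: cvg_comp.
move=> A [e /= e0 eA]; have := continuous_clamp => /(_ y) /cvgrPdist_lt /(_ _ e0).
apply: filterS => z /= h; apply: eA => //; exact: clamp_in.
Qed.

End clamp.

Section interval_integral.
Context {R : realType} (l r : R).
Hypothesis lr : l < r.
Let mu := @lebesgue_measure R.
Implicit Types f g : R -> R.

Definition bounded_meas f b := measurable_fun setT f /\ forall x, `|f x| <= b.

(** This turns integrals on [l, r] into integrals for a probability measure. *)
Lemma interval_mean f b : bounded_meas f b ->
  \int[mu]_(x in `[l, r]) f x = (r - l) * \int[uniform_prob lr]_x f x.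
Proof.
move=> [mf fb].
have b0 : 0 <= b by apply: le_trans (fb 0).
have rl0 : 0 < r - l by rewrite subr_gt0.
have mfb : measurable_fun setT (fun x => f x + b).
  by apply: measurable_funD => //; exact: measurable_cst.
have muI : (mu `[l, r] < +oo)%E by rewrite /mu lebesgue_measure_itv/= lte_fin lr ltry.
have iI h c : bounded_meas h c -> mu.-integrable `[l, r] (EFin \o h).
  move=> [mh hc]; apply: measurable_bounded_integrable => //.
    exact: measurable_funS mh.
  exists c; split; first exact: num_real.
  by move=> M cM x _ /=; rewrite (le_trans (hc x))// ltW.
have cstb : bounded_meas (fun=> b) `|b| by split => //; exact: measurable_cst.
have h : \int[mu]_(x in `[l, r]) (f x + b) = (r - l) * \int[uniform_prob lr]_x (f x + b).
  rewrite /Rintegral integral_uniform//=.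
  - rewrite fineM//; last first.
      apply: integrable_fin_num => //; apply: (iI _ (b + b)); split => // x.
      by rewrite (le_trans (ler_normD _ _))// lerD// ger0_norm.
    by rewrite /= mulrA mulfV ?mul1r// gt_eqF.
  - exact/measurable_EFinP.
  - by move=> x; rewrite lee_fin -lerBlDr sub0r; have := fb x; rewrite ler_norml => /andP[].
move: h; rewrite RintegralD//; [|exact: iI (conj mf fb)|exact: iI cstb].
rewrite RintegralD//; [|exact: (@bounded_integrable _ _ _ _ _ b)|exact: (@bounded_integrable _ _ _ _ _ `|b|)].
have muE : mu `[l, r] = (r - l)%:E by rewrite /mu lebesgue_measure_itv/= lte_fin lr.
rewrite Rintegral_prob_cst Rintegral_cst// [X in b * X](congr1 fine muE) /=.
rewrite mulrDr; lra.
Qed.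

End interval_integral.

(** * Densities and affine changes of variable *)

(** By uniqueness g is the Radon-Nikodym derivative of nu. *)
Lemma borel_density_integral {R : realType} (nu : probability (measurableTypeR R) R)
    (g f : R -> R) b :
  measurable_fun setT g -> (forall x, 0 <= g x) ->
  (forall A : set R, measurable A ->
     nu A = (\int[lebesgue_measure]_(x in A) (g x)%:E)%E) ->
  bounded_meas f b ->
  \int[nu]_x f x = \int[lebesgue_measure]_x (f x * g x).
Proof.
move=> mg g0 nuE [mf fb].
have mgE : measurable_fun setT (EFin \o g) by exact/measurable_EFinP.
have nudom : nu `<< (@lebesgue_measure R).
  apply/null_content_dominatesP => A mA A0; rewrite nuE//.
  by apply: null_set_integral => //; exact: measurable_funTS.
have ig : (@lebesgue_measure R).-integrable setT (EFin \o g).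
  apply/integrableP; split => //.
  under eq_integral do rewrite /= ger0_norm//.
  by rewrite -nuE// (@probability_setT _ _ _ nu) ltry.
have ae : ae_eq (@lebesgue_measure R) setT (EFin \o g)
    (Radon_Nikodym (charge_of_finite_measure nu) (@lebesgue_measure R)).
  apply: integral_ae_eq => //.
  move=> E _ mE; rewrite -Radon_Nikodym_integral//.
  by rewrite -[RHS]/(nu E) nuE.
have nuf : nu.-integrable setT (EFin \o f) by exact: (@bounded_integrable _ _ _ _ _ b).
have := Radon_Nikodym_change_of_variables nudom measurableT nuf.
rewrite /Rintegral => <-; congr fine.
apply: ae_eq_integral => //.
- apply: emeasurable_funM; first exact/measurable_EFinP.
  by [].
- by apply/measurable_EFinP; apply: measurable_funM.
- apply: filterS ae => x /= h _; rewrite EFinM; congr (_ * _)%E.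
  by rewrite -h.
Qed.

(** The sigma-algebra carried by a realType and the one on which Lebesgue measure lives
have the same sets but are different structures; nu is transported along the
identity. *)
Lemma density_integral {R : realType} (nu : probability R R) (g f : R -> R) b :
  measurable_fun setT g -> (forall x, 0 <= g x) ->
  (forall A : set R, measurable A ->
     nu A = (\int[lebesgue_measure]_(x in A) (g x)%:E)%E) ->
  bounded_meas f b ->
  \int[nu]_x f x = \int[lebesgue_measure]_x (f x * g x).
Proof.
move=> mg g0 nuE fb; have [mf bf] := fb.
have mid : measurable_fun setT (idfun : R -> measurableTypeR R).
  by move=> _ B mB; rewrite setTI; exact: mB.
pose idR : {mfun R >-> measurableTypeR R} :=
  HB.pack (idfun : R -> measurableTypeR R) (isMeasurableFun.Build _ _ _ _ _ mid).
rewrite -(@borel_density_integral _ (distribution nu idR) g f b)//.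
rewrite /Rintegral integral_distribution//; first exact/measurable_EFinP.
exact: (@bounded_integrable _ _ _ nu _ b).
Qed.

Lemma affine_substitution {R : realType} (H : R -> R) (m s l r : R) : l <= r -> 0 < s ->
  continuous H ->
  \int[lebesgue_measure]_(z in `[l, r]) H z =
  \int[lebesgue_measure]_(u in `[(l - m) / s, (r - m) / s]) (H (m + s * u) * s).
Proof.
move=> lr s0 cH.
pose F u : R := m + s * u.
have Fl : F ((l - m) / s) = l by rewrite /F mulrC divfK ?gt_eqF// addrC subrK.
have Fr : F ((r - m) / s) = r by rewrite /F mulrC divfK ?gt_eqF// addrC subrK.
have FE : F = cst m + s *: (id : R -> R) by apply/funext.
have dF x : is_derive x (1 : R) F s.
  have := is_deriveD (is_derive_cst m x (1 : R)) (is_deriveZ s (is_derive_id x (1 : R))).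
  by rewrite -FE add0r -[s *: 1]/(s * 1) mulr1.
have F' : derive1 F = fun=> s.
  by apply/funext => x; rewrite derive1E; exact: derive_val.
have cF : continuous F.
  by move=> x; apply: differentiable_continuous; apply/derivable1_diffP; case: (dF x).
have := @integration_by_substitution_increasing R F H ((l - m) / s) ((r - m) / s).
rewrite Fl Fr F' /Rintegral => ->//.
- by rewrite ler_pM2r ?invr_gt0// lerD2r.
- by move=> x y _ _ xy; rewrite /F ltrD2l ltr_pM2l.
- by move=> x _; exact: cst_continuous.
- exact: is_cvg_cst.
- exact: is_cvg_cst.
- split; first by move=> x _; case: (dF x).
  + exact/cvg_at_right_filter/cF.
  + exact/cvg_at_left_filter/cF.
- exact: continuous_subspaceT.
Qed.

(** * Functions of bounded variation and the spectral gap *)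

Section fubini.
Context {R : realType} d1 d2 (T1 : measurableType d1) (T2 : measurableType d2).
Context (P1 : probability T1 R) (P2 : probability T2 R).

Lemma Rintegral_prod (f : T1 -> T2 -> R) b :
  measurable_fun setT (fun p : T1 * T2 => f p.1 p.2) ->
  (forall x y, `|f x y| <= b) ->
  \int[P1]_x \int[P2]_y f x y = \int[(P1 \x P2)%E]_p f p.1 p.2.
Proof.
move=> mf fb.
have i12 : (P1 \x P2)%E.-integrable setT (EFin \o (fun p : T1 * T2 => f p.1 p.2)).
  by apply: (@bounded_integrable _ _ _ _ _ b) => // p; exact: fb.
rewrite {3}/Rintegral -[X in fine X](integral12_prod_meas1 i12).
rewrite {1}/Rintegral; congr fine; apply: eq_integral => x _.
rewrite /fubini_F fineK// integrable_fin_num//.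
apply: (@bounded_integrable _ _ _ _ _ b); last exact: fb.
exact: (measurableT_comp mf (pair1_measurable x)).
Qed.

Lemma Rintegral_swap (f : T1 -> T2 -> R) b :
  measurable_fun setT (fun p : T1 * T2 => f p.1 p.2) ->
  (forall x y, `|f x y| <= b) ->
  \int[P1]_x \int[P2]_y f x y = \int[P2]_y \int[P1]_x f x y.
Proof.
move=> mf fb; rewrite (Rintegral_prod mf fb).
have i12 : (P1 \x P2)%E.-integrable setT (EFin \o (fun p : T1 * T2 => f p.1 p.2)).
  by apply: (@bounded_integrable _ _ _ _ _ b) => // p; exact: fb.
rewrite {1}/Rintegral -[X in fine X](integral21_prod_meas1 i12).
rewrite {2}/Rintegral; congr fine; apply: eq_integral => y _.
rewrite /fubini_G fineK// integrable_fin_num//.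
apply: (@bounded_integrable _ _ _ _ _ b); last by move=> x; exact: fb.
exact: (measurableT_comp mf (pair2_measurable y)).
Qed.

End fubini.

Section BV_integrals.
Context {R : realType} (l r : R).
Hypothesis lr : l < r.
Let mu := @lebesgue_measure R.
Let cl := clamp l r.
Let lr' : l <= r := ltW lr.
Implicit Types f g : R -> R.

(** Composing with the clamping map makes the condition independent of the values of f
outside [l, r]. *)
Definition bounded_meas_on f := exists b, bounded_meas (f \o cl) b.

Lemma interval_integral_eq f g : BVeq l r f g ->
  \int[mu]_(x in `[l, r]) f x = \int[mu]_(x in `[l, r]) g x.
Proof. by move=> fg; apply: eq_Rintegral => x; rewrite inE; exact: fg. Qed.

Lemma interval_integral_clamp f :
  \int[mu]_(x in `[l, r]) f x = \int[mu]_(x in `[l, r]) f (cl x).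
Proof. by apply: interval_integral_eq => x xI; rewrite /cl clamp_id. Qed.

Lemma interval_integralE f : bounded_meas_on f ->
  \int[mu]_(x in `[l, r]) f x = (r - l) * \int[uniform_prob lr]_x f (cl x).
Proof. by move=> [b fb]; rewrite interval_integral_clamp (interval_mean lr fb). Qed.

Lemma bounded_meas_onD f g : bounded_meas_on f -> bounded_meas_on g ->
  bounded_meas_on (fun x => f x + g x).
Proof.
move=> [b [mf fb]] [c [mg gc]]; exists (b + c); split.
  exact: measurable_funD.
by move=> x; rewrite (le_trans (ler_normD _ _))//; apply: lerD; [exact: fb|exact: gc].
Qed.

Lemma bounded_meas_onM f g : bounded_meas_on f -> bounded_meas_on g ->
  bounded_meas_on (fun x => f x * g x).
Proof.
move=> [b [mf fb]] [c [mg gc]]; exists (b * c); split.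
  exact: measurable_funM.
by move=> x; rewrite /= normrM ler_pM//; [exact: fb|exact: gc].
Qed.

Lemma bounded_meas_on_norm f : bounded_meas_on f -> bounded_meas_on (fun x => `|f x|).
Proof.
move=> [b [mf fb]]; exists b; split; first exact: (measurableT_comp (@normr_measurable _ setT) mf).
by move=> x; rewrite /= normr_id; exact: fb.
Qed.

Lemma bounded_meas_on_eq f g : BVeq l r f g -> bounded_meas_on f -> bounded_meas_on g.
Proof.
move=> fg [b fb]; exists b; rewrite (_ : g \o cl = f \o cl)//.
by apply/funext => x /=; rewrite fg//; exact: clamp_in.
Qed.

Lemma bounded_meas_on_cst k : bounded_meas_on (fun=> k).
Proof. by exists `|k|; split => //; exact: measurable_cst. Qed.

Lemma interval_integralD f g : bounded_meas_on f -> bounded_meas_on g ->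
  \int[mu]_(x in `[l, r]) (f x + g x) =
  \int[mu]_(x in `[l, r]) f x + \int[mu]_(x in `[l, r]) g x.
Proof.
move=> fb gb; rewrite !interval_integralE//; last exact: bounded_meas_onD.
case: fb gb => b [mf fb] [c [mg gc]].
rewrite RintegralD ?mulrDr//; [exact: (@bounded_integrable _ _ _ _ _ b)|].
exact: (@bounded_integrable _ _ _ _ _ c).
Qed.

Lemma interval_integralZ k f : bounded_meas_on f ->
  \int[mu]_(x in `[l, r]) (k * f x) = k * \int[mu]_(x in `[l, r]) f x.
Proof.
move=> fb; rewrite !interval_integralE//; last first.
  by apply: bounded_meas_onM => //; exact: bounded_meas_on_cst.
case: fb => b [mf fb]; rewrite RintegralZl//; first by rewrite mulrCA.
exact: (@bounded_integrable _ _ _ _ _ b).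
Qed.

Lemma interval_integral_cst k : \int[mu]_(x in `[l, r]) k = (r - l) * k.
Proof.
by rewrite interval_integralE ?Rintegral_prob_cst//; exact: bounded_meas_on_cst.
Qed.

Lemma le_interval_integral f g : bounded_meas_on f -> bounded_meas_on g ->
  (forall x, x \in `[l, r] -> f x <= g x) ->
  \int[mu]_(x in `[l, r]) f x <= \int[mu]_(x in `[l, r]) g x.
Proof.
move=> fb gb fg; rewrite !interval_integralE//.
rewrite ler_wpM2l ?subr_ge0//.
case: fb gb => b [mf fb] [c [mg gc]].
apply: le_Rintegral => //; [exact: (@bounded_integrable _ _ _ _ _ b)|
  exact: (@bounded_integrable _ _ _ _ _ c)|].
by move=> x _; apply: fg; exact: clamp_in.
Qed.

Lemma norm_interval_integral f : bounded_meas_on f ->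
  `|\int[mu]_(x in `[l, r]) f x| <= \int[mu]_(x in `[l, r]) `|f x|.
Proof.
move=> fb; rewrite ler_norml; apply/andP; split; last first.
  by apply: le_interval_integral => //; [exact: bounded_meas_on_norm|move=> x _; exact: ler_norm].
rewrite lerNl -mulN1r -interval_integralZ//.
apply: le_interval_integral.
- by apply: bounded_meas_onM => //; exact: bounded_meas_on_cst.
- exact: bounded_meas_on_norm.
- by move=> x _; rewrite mulN1r -normrN ler_norm.
Qed.

Lemma nondecreasing_bounded_meas_on f :
  {in `[l, r] &, {homo f : x y / x <= y}} -> bounded_meas_on f.
Proof.
move=> ndf; have lI : l \in `[l, r] by rewrite in_itv/= lexx lr'.
have rI : r \in `[l, r] by rewrite in_itv/= lexx lr'.
exists (`|f l| + `|f r|); split.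
  apply: nondecreasing_measurable => // x y xy; apply: ndf; rewrite ?clamp_in//.
  by rewrite /cl /clamp le_max2// le_min2.
move=> x /=; have xI := clamp_in lr' x; have := xI; rewrite in_itv/= => /andP[lx xr].
have h1 := ndf _ _ lI xI lx; have h2 := ndf _ _ xI rI xr.
have := ler_norm (f r); have := ler_norm (- f l); rewrite normrN.
have := normr_ge0 (f l); have := normr_ge0 (f r).
by rewrite ler_norml => *; apply/andP; split; rewrite -/cl in h1 h2 *; lra.
Qed.

Lemma BV_bounded_meas_on f : BV l r f -> bounded_meas_on f.
Proof.
move=> BVf; have BVNf := bounded_variationN BVf.
have h1 : bounded_meas_on (fine \o pos_tv l f).
  by apply: nondecreasing_bounded_meas_on; exact: (fine_neg_tv_nondecreasing BVNf).
have h2 : bounded_meas_on (fine \o neg_tv l f).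
  by apply: nondecreasing_bounded_meas_on; exact: (fine_neg_tv_nondecreasing BVf).
have h3 : bounded_meas_on (fun x => -1 * (fine \o neg_tv l f) x).
  by apply: bounded_meas_onM => //; exact: bounded_meas_on_cst.
apply: bounded_meas_on_eq (bounded_meas_onD h1 h3) => x xI /=.
by rewrite (bounded_variation_pos_neg_tvE BVf)//= mulN1r.
Qed.

Lemma L1_le_BVnorm f : \int[mu]_(x in `[l, r]) `|f x| <= BVnorm l r f.
Proof. by rewrite /BVnorm lerDr fine_ge0// total_variation_ge0. Qed.

Lemma BV_cst k : BV l r (fun=> k).
Proof. by apply: nondecreasing_bounded_variation. Qed.

(** Let J be the integral over [l, r].  Integrating A f = Pi f + N f with f replaced by
N^(n+1) f gives J (N^(n+2) f) = J (N^(n+1) f), since Pi N = 0; these integrals tend to 0, so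
J (N f) = 0 and J (Pi f) = J f.  As Pi has rank one and its range is not
contained in the kernel of J, it vanishes where J does, and A^n f = N^n f for
such f. *)
Lemma spectral_gap_decay (A : (R -> R) -> R -> R) :
  spectral_gap l r A ->
  (forall f g, BVeq l r f g -> A f = A g) ->
  (forall f, BV l r f ->
     \int[mu]_(x in `[l, r]) A f x = \int[mu]_(x in `[l, r]) f x) ->
  exists M rho : R, 0 <= rho < 1 /\
    forall f, BV l r f -> \int[mu]_(x in `[l, r]) f x = 0 ->
    forall n, exists2 fn, BV l r fn &
      BVeq l r (iter n A f) fn /\ BVnorm l r fn <= M * rho ^+ n * BVnorm l r f.
Proof.
move=> [Pi [N [[[BVPi linPi _] [BVN _ _]] AE [h [BVh _ _ Pih]] PiN [M [rho [rho01 decay]]]]]] Aeq mass.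
pose J f := \int[mu]_(x in `[l, r]) f x.
have BVNn n f : BV l r f -> BV l r (iter n N f).
  by move=> BVf; elim: n => //= n; exact: BVN.
have JA f : BV l r f -> J f = J (Pi f) + J (N f).
  move=> BVf; rewrite /J -mass// (interval_integral_eq (AE f BVf)).
  by rewrite interval_integralD//; apply: BV_bounded_meas_on; [exact: BVPi|exact: BVN].
have JNn n f : BV l r f -> J (iter n.+1 N f) = J (N f).
  move=> BVf; elim: n => // n <-.
  rewrite (JA _ (BVNn n.+1 f BVf)).
  have -> : J (Pi (iter n.+1 N f)) = 0.
    have [h1 _] := PiN _ (BVNn n f BVf).
    by rewrite /J (interval_integral_eq h1) interval_integral_cst mulr0.
  by rewrite add0r.
have JN0 f : BV l r f -> J (N f) = 0.
  move=> BVf; apply/eqP; rewrite -normr_le0; apply/ler_addgt0Pr => e e0; rewrite add0r.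
  have : M * rho ^+ n * BVnorm l r f @[n --> \oo] --> M * 0 * BVnorm l r f.
    apply: cvgMl; apply: cvgMr.
    by apply: cvg_expr; case/andP: rho01 => r0 r1; rewrite ger0_norm.
  rewrite mulr0 mul0r => /cvgrPdist_lt /(_ _ e0) [n _ /(_ n.+1 (leqnSn n))] /=.
  rewrite sub0r normrN => small.
  rewrite -(JNn n)// (le_trans (norm_interval_integral _))//.
    exact/BV_bounded_meas_on/BVNn.
  apply: (le_trans (L1_le_BVnorm _)); apply: (le_trans (decay _ _ BVf)).
  by apply: (le_trans (ler_norm _)); exact: ltW.
have JPi f : BV l r f -> J (Pi f) = J f by move=> BVf; rewrite (JA f)// JN0// addr0.
(* Otherwise J (Pi 1) = 0, whereas J 1 is the length of the interval. *)
have Jh : J h != 0.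
  have [k kE] := Pih _ (BV_cst 1).
  apply/eqP => Jh0; have := JPi _ (BV_cst 1).
  rewrite /J (interval_integral_eq kE) interval_integralZ; last exact: BV_bounded_meas_on.
  rewrite -/(J h) Jh0 mulr0 interval_integral_cst mulr1 => /eqP.
  by rewrite eq_sym subr_eq0 gt_eqF.
exists M, rho; split => // f BVf Jf n; exists (iter n N f); first exact: BVNn.
split; last exact: decay.
have Pi0 : BVeq l r (Pi f) (fun=> 0).
  have [k kE] := Pih _ BVf.
  have := JPi _ BVf; rewrite /J (interval_integral_eq kE) interval_integralZ; last exact: BV_bounded_meas_on.
  rewrite Jf => /eqP; rewrite mulf_eq0 (negbTE Jh) orbF => /eqP k0 x xI.
  by rewrite kE// k0 mul0r.
elim: n => // n IH /=; rewrite (Aeq _ _ IH) => x xI.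
rewrite AE//; last exact: BVNn.
suff -> : Pi (iter n N f) x = 0 by rewrite add0r.
case: n {IH} => [|n]; first exact: Pi0.
by have [h1 _] := PiN _ (BVNn n f BVf); exact: h1.
Qed.

End BV_integrals.

(** * From the spectral gap to uniform mixing *)

Lemma lipschitz_BV {R : realType} (l r k : R) (f : R -> R) : l <= r -> 0 <= k ->
  (forall x y, `|f x - f y| <= k * `|x - y|) ->
  BV l r f /\ fine (total_variation l r f) <= k * (r - l).
Proof.
move=> lr k0 fk.
have bnd s : itv_partition l r s -> variation l r f s <= k * (r - l).
  move=> prs; have nd : {in `[l, r] &, nondecreasing_fun (fun x => k * x)}.
    by move=> x y _ _ xy; apply: ler_wpM2l.
  rewrite mulrBr -(nondecreasing_variation nd prs).
  rewrite /variation; apply: ler_sum => n _ /=.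
  by rewrite -mulrBr normrM ger0_norm.
have ubd : ubound (variations l r f) (k * (r - l)).
  by move=> _ [s prs <-]; exact: bnd.
have BVf : BV l r f by exists (k * (r - l)).
split => //; rewrite -lee_fin fineK; last exact/bounded_variationP.
by apply: ge_ereal_sup => _ [v [s prs <-] <-]; rewrite lee_fin; exact: bnd.
Qed.

Section density_kernel.
Context {R : realType} (l r : R) (p : R -> R -> R) (pmax plip : R).
Context (nu : probability R R) (F : R -> R -> R).
Let mu := @lebesgue_measure R.
Let cl := clamp l r.
Hypotheses (lr : l < r)
  (p_measurable : measurable_fun setT (fun q : R * R => p (cl q.1) q.2))
  (p_le : forall x z, `|p (cl x) z| <= pmax)
  (p_lipschitz : forall x z z', `|p (cl x) z - p (cl x) z'| <= plip * `|z - z'|)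
  (p_integral : forall x, \int[mu]_(z in `[l, r]) p (cl x) z = 1).
Hypotheses (F_measurable : forall x, measurable_fun setT (F x))
  (F_continuous : forall u, continuous (F^~ u)).
Hypothesis transition_p : forall G b x, continuous_bounded G b ->
  transition nu F G x = \int[mu]_(z in `[l, r]) (G z * p (cl x) z).

Let A := markov_operator l r p.
Let lr' : l <= r := ltW lr.

Lemma markov_operator_eq f g : BVeq l r f g -> A f = A g.
Proof.
move=> fg; apply/funext => z; apply: interval_integral_eq => x xI.
by rewrite fg.
Qed.

Lemma clamp_idem x : cl (cl x) = cl x.
Proof. by rewrite /cl clamp_id//; exact: clamp_in. Qed.

Lemma measurable_duality_integrand f G : bounded_meas_on l r f -> bounded_meas_on l r G ->
  measurable_fun setT (fun q : R * R => f (cl q.1) * p (cl q.1) (cl q.2) * G (cl q.2)).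
Proof.
move=> [b [mf _]] [c [mG _]].
apply: measurable_funM; last exact: (measurableT_comp mG measurable_snd).
apply: measurable_funM; first exact: (measurableT_comp mf measurable_fst).
apply: (measurableT_comp p_measurable (g := fun q : R * R => (q.1, cl q.2))).
apply: measurable_fun_pair; first exact: measurable_fst.
apply: measurableT_comp => //; apply: continuous_measurable; exact: continuous_clamp.
Qed.

Lemma bounded_meas_on_kernel f z : bounded_meas_on l r f ->
  bounded_meas_on l r (fun x => f x * p x z).
Proof.
move=> fb; apply: bounded_meas_onM => //; exists pmax; split; last by move=> x; exact: p_le.
exact: (measurableT_comp p_measurable (pair2_measurable z)).
Qed.

Lemma bounded_meas_on_markov_operator f : bounded_meas_on l r f -> bounded_meas_on l r (A f).
Proof.
move=> fb; have [b [mf bf]] := fb.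
exists ((r - l) * (b * pmax)).
have E z : A f z = (r - l) * \int[uniform_prob lr]_x (f (cl x) * p (cl x) z).
  by rewrite -(interval_integralE lr (bounded_meas_on_kernel z fb)).
have mfp : measurable_fun setT (fun q : R * R => f (cl q.1) * p (cl q.1) q.2).
  by apply: measurable_funM => //; exact: (measurableT_comp mf measurable_fst).
have fpb x z : `|f (cl x) * p (cl x) z| <= b * pmax.
  by rewrite normrM ler_pM//; exact: bf.
split.
  rewrite (_ : A f \o cl = fun z => (r - l) * \int[uniform_prob lr]_x (f (cl x) * p (cl x) (cl z))); last first.
    by apply/funext => z /=; rewrite E.
  apply: measurable_funM; first exact: measurable_cst.
  apply: (@measurable_Rintegral _ _ _ (uniform_prob lr) _ R (fun z x => f (cl x) * p (cl x) (cl z)) (b * pmax)) => //.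
  have mcl : measurable_fun setT (fun q : R * R => (q.2, cl q.1)).
    apply: measurable_fun_pair; first exact: measurable_snd.
    by apply: measurableT_comp => //; apply: continuous_measurable; exact: continuous_clamp.
  exact: (measurableT_comp mfp mcl).
move=> z /=; rewrite E normrM ger0_norm ?subr_ge0// ler_wpM2l ?subr_ge0//.
apply: Rintegral_prob_le => //.
exact: (measurableT_comp mfp (pair2_measurable (cl z))).
Qed.

Lemma continuous_bounded_on G b : continuous_bounded G b -> bounded_meas_on l r G.
Proof.
move=> [cG Gb]; exists b; split; last by move=> x; exact: Gb.
apply: measurableT_comp; last by apply: continuous_measurable; exact: continuous_clamp.
exact: continuous_measurable.
Qed.

(** Fubini's theorem, for the uniform law on [l, r] in both variables. *)
Lemma markov_operator_duality f G b : bounded_meas_on l r f -> continuous_bounded G b ->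
  \int[mu]_(z in `[l, r]) (A f z * G z) =
  \int[mu]_(x in `[l, r]) (f x * transition nu F G x).
Proof.
move=> fb Gb; have GI := continuous_bounded_on Gb.
have QI : bounded_meas_on l r (transition nu F G).
  by apply: continuous_bounded_on; exact: transition_continuous_bounded Gb.
rewrite !(interval_integralE lr); last 2 first.
- exact: bounded_meas_onM.
- by apply: bounded_meas_onM => //; exact: bounded_meas_on_markov_operator.
congr (_ * _).
have [bf [mf fbf]] := fb; have [bG [mG GbG]] := GI.
have mH := measurable_duality_integrand fb GI.
have Hb x z : `|f (cl x) * p (cl x) (cl z) * G (cl z)| <= bf * pmax * bG.
  by rewrite !normrM ler_pM ?mulr_ge0//; [rewrite ler_pM//; exact: fbf|exact: GbG].
transitivity ((r - l) * \int[uniform_prob lr]_z \int[uniform_prob lr]_x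
    (f (cl x) * p (cl x) (cl z) * G (cl z))).
  rewrite -RintegralZl//; last first.
    apply: (@bounded_integrable _ _ _ _ _ (bf * pmax * bG)).
      apply: (@measurable_Rintegral _ _ _ (uniform_prob lr) _ R (fun z x => f (cl x) * p (cl x) (cl z) * G (cl z)) (bf * pmax * bG)) => //.
      exact: (measurableT_comp mH (@measurable_swap _ _ _ _)).
    move=> z; apply: Rintegral_prob_le => //.
    exact: (measurableT_comp mH (pair2_measurable z)).
  apply: eq_Rintegral => z _.
  rewrite RintegralZr//.
    rewrite -/(A f) mulrA; congr (_ * _).
    exact: (interval_integralE lr (bounded_meas_on_kernel (cl z) fb)).
  have [c [mc cb]] := bounded_meas_on_kernel (cl z) fb.
  exact: (@bounded_integrable _ _ _ _ _ c).
transitivity ((r - l) * \int[uniform_prob lr]_x \int[uniform_prob lr]_z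
    (f (cl x) * p (cl x) (cl z) * G (cl z))).
  apply: (congr1 (fun z => (r - l) * z)); apply: esym.
  exact: (@Rintegral_swap R _ _ _ _ (uniform_prob lr) (uniform_prob lr)
    (fun x z => f (cl x) * p (cl x) (cl z) * G (cl z)) _ mH Hb).
have mz x : measurable_fun setT (fun z => f (cl x) * p (cl x) (cl z) * G (cl z)).
  exact: (measurableT_comp mH (pair1_measurable x)).
rewrite -RintegralZl//; last first.
  apply: (@bounded_integrable _ _ _ _ _ (bf * pmax * bG)).
    exact: (@measurable_Rintegral _ _ _ (uniform_prob lr) _ R (fun x z => f (cl x) * p (cl x) (cl z) * G (cl z)) (bf * pmax * bG)).
  by move=> x; apply: Rintegral_prob_le; [exact: mz|move=> z; exact: Hb].
apply: eq_Rintegral => x _.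
have pI : bounded_meas_on l r (fun z => G z * p (cl (cl x)) z).
  apply: bounded_meas_onM => //; exists pmax; split; last by move=> z; exact: p_le.
  apply: measurableT_comp; last by apply: continuous_measurable; exact: continuous_clamp.
  exact: (measurableT_comp p_measurable (pair1_measurable (cl x))).
rewrite (transition_p _ Gb) (interval_integralE lr pI) mulrCA; congr (_ * _).
rewrite -RintegralZl//; last first.
  by case: pI => c [mc cb]; exact: (@bounded_integrable _ _ _ _ _ c).
by apply: eq_Rintegral => z _; rewrite clamp_idem; ring.
Qed.

(** The dual statement to the fact that transitions preserve constants. *)
Lemma markov_operator_mass f : BV l r f ->
  \int[mu]_(x in `[l, r]) A f x = \int[mu]_(x in `[l, r]) f x.
Proof.
move=> BVf; have fb := BV_bounded_meas_on lr BVf.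
have c1 : continuous_bounded (fun=> 1 : R) 1.
  by split => [y|y]; [exact: cvg_cst|rewrite normr1].
have := markov_operator_duality fb c1.
under eq_Rintegral do rewrite mulr1.
move=> ->; apply: eq_Rintegral => x _.
by rewrite /transition Rintegral_prob_cst mulr1.
Qed.

Lemma iter_duality f G b k :
  (forall j, bounded_meas_on l r (iter j A f)) -> continuous_bounded G b ->
  \int[mu]_(x in `[l, r]) (f x * iter k (transition nu F) G x) =
  \int[mu]_(x in `[l, r]) (iter k A f x * G x).
Proof.
move=> fb; elim: k G => // k IH G Gb.
rewrite iterSr IH; last exact: transition_continuous_bounded Gb.
by rewrite /= (markov_operator_duality (fb k) Gb).
Qed.

Hypothesis gap : spectral_gap l r A.

(** The difference of the two means is the integral of G against A^k f with
f = p (x, .) - p (x', .), a function of integral zero whose norm is bounded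
independently of x and x'. *)
Theorem spectral_gap_mixing : exists C rho : R, [/\ 0 <= C, 0 <= rho < 1 &
  forall k G b, continuous_bounded G b -> forall x x',
    `|iter k.+1 (transition nu F) G x - iter k.+1 (transition nu F) G x'|
      <= C * rho ^+ k.+1 * b].
Proof.
have [M [rho [/andP[rho0 rho1] decay]]] := spectral_gap_decay lr gap markov_operator_eq markov_operator_mass.
have k0 : 0 <= plip.
  by have := p_lipschitz 0 0 1; rewrite sub0r normrN1 mulr1; exact: le_trans.
pose D := 2 * plip * (r - l) + (r - l) * (2 * pmax).
have pmax0 : 0 <= pmax by exact: le_trans (p_le 0 0).
have rl0 : 0 <= r - l by rewrite subr_ge0.
have D0 : 0 <= D by rewrite addr_ge0// !mulr_ge0.
(* One power of the rate is divided by below, so it has to be positive. *)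
pose rho' := Num.max rho (1 / 2).
have rho'0 : 0 < rho' by rewrite lt_max; apply/orP; right; lra.
exists (`|M| * D / rho'), rho'; split.
- by rewrite !mulr_ge0// invr_ge0 ltW.
- by rewrite ltW//= gt_max rho1; lra.
move=> k G b Gb x x'.
have [_ bG] := Gb; have b0 : 0 <= b by exact: le_trans (bG 0).
pose f z := p (cl x) z - p (cl x') z.
have flip y z : `|f y - f z| <= 2 * plip * `|y - z|.
  have -> : f y - f z =
    (p (cl x) y - p (cl x) z) - (p (cl x') y - p (cl x') z) by rewrite /f; ring.
  rewrite (le_trans (ler_normB _ _))// -mulrA mulr_natl mulr2n.
  by rewrite lerD.
have [BVf TVf] := lipschitz_BV lr' (mulr_ge0 (ler0n _ 2) k0) flip.
have pI y : bounded_meas_on l r (p (cl y)).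
  exists pmax; split; last by move=> z; exact: p_le.
  apply: measurableT_comp; last by apply: continuous_measurable; exact: continuous_clamp.
  exact: (measurableT_comp p_measurable (pair1_measurable y)).
have NpI y : bounded_meas_on l r (fun z => -1 * p (cl y) z).
  by apply: bounded_meas_onM => //; exact: bounded_meas_on_cst.
have fE : f = (fun z => p (cl x) z + -1 * p (cl x') z).
  by apply/funext => z; rewrite mulN1r.
have Jf : \int[mu]_(z in `[l, r]) f z = 0.
  rewrite fE interval_integralD// interval_integralZ// !p_integral; lra.
have normf : BVnorm l r f <= D.
  apply: lerD => //; rewrite -(interval_integral_cst lr).
  apply: le_interval_integral => //.
  - exact/bounded_meas_on_norm/BV_bounded_meas_on.
  - exact: bounded_meas_on_cst.
  - move=> z _; rewrite (le_trans (ler_normB _ _))// mulr_natl mulr2n.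
    by rewrite lerD.
have Ifj j : bounded_meas_on l r (iter j A f).
  have [fn BVfn [e _]] := decay _ BVf Jf j.
  apply: bounded_meas_on_eq (BV_bounded_meas_on lr BVfn) => // z zI.
  by rewrite e.
have GI := continuous_bounded_on Gb.
have -> : iter k.+1 (transition nu F) G x - iter k.+1 (transition nu F) G x' =
   \int[mu]_(z in `[l, r]) (iter k A f z * G z).
  rewrite -(iter_duality k Ifj Gb).
  have kb := iter_transition_continuous_bounded nu F_measurable F_continuous k Gb.
  have kI := continuous_bounded_on kb.
  rewrite /= !(transition_p _ kb).
  rewrite fE.
  under [RHS]eq_Rintegral do rewrite mulrDl -mulrA.
  rewrite interval_integralD//; last 2 first.
  - exact: bounded_meas_onM.
  - by apply: bounded_meas_onM; [exact: bounded_meas_on_cst|exact: bounded_meas_onM].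
  rewrite interval_integralZ//; last exact: bounded_meas_onM.
  rewrite mulN1r; congr (_ - _); apply: eq_Rintegral => z _; exact: mulrC.
have [fn BVfn [e bfn]] := decay _ BVf Jf k.
apply: (le_trans (norm_interval_integral lr _)); first exact: bounded_meas_onM.
apply: (@le_trans _ _ (\int[mu]_(z in `[l, r]) (b * `|fn z|))).
  apply: le_interval_integral => //.
  - exact/bounded_meas_on_norm/bounded_meas_onM.
  - apply: bounded_meas_onM; first exact: bounded_meas_on_cst.
    exact/bounded_meas_on_norm/BV_bounded_meas_on.
  - by move=> z zI; rewrite e// normrM mulrC ler_wpM2r.
rewrite interval_integralZ//; last exact/bounded_meas_on_norm/BV_bounded_meas_on.
rewrite mulrC ler_wpM2r//.
apply: (le_trans (L1_le_BVnorm lr _)); apply: (le_trans bfn).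
have -> : `|M| * D / rho' * rho' ^+ k.+1 = `|M| * rho' ^+ k * D.
  by rewrite exprS; field; rewrite gt_eqF.
have nf0 : 0 <= BVnorm l r f.
  by apply: le_trans (L1_le_BVnorm lr f); apply: Rintegral_ge0.
apply: (@le_trans _ _ (`|M| * rho' ^+ k * BVnorm l r f)); last first.
  by rewrite ler_wpM2l// mulr_ge0// exprn_ge0// ltW.
rewrite ler_wpM2r//; apply: (@le_trans _ _ (`|M| * rho ^+ k)).
  by rewrite ler_wpM2r ?exprn_ge0// ler_norm.
rewrite ler_wpM2l// lerXn2r ?nnegrE// ?(ltW rho'0)//.
by rewrite le_max lexx.
Qed.
End density_kernel.

(** * The transition density of a map with additive noise *)

Section additive_noise.
Context {R : realType} (l r a : R) (T sigma g : R -> R) (sigma0 gmax glip : R).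
Context (nu : probability R R).
Hypotheses (lr : l < r) (T_continuous : {within `[l, r], continuous T})
  (sigma_continuous : continuous sigma) (sigma0_gt0 : 0 < sigma0)
  (sigma_ge : forall x, x \in `[l, r] -> sigma0 <= sigma x)
  (range : forall x, x \in `[l, r] ->
     l <= T x - a * sigma x /\ T x + a * sigma x <= r)
  (a_gt0 : 0 < a) (g_ge0 : forall x, 0 <= g x) (g_le : forall x, g x <= gmax)
  (g_lipschitz : forall x y, `|g x - g y| <= glip * `|x - y|)
  (g_support : forall x, a < `|x| -> g x = 0)
  (g_density : forall A : set R, measurable A ->
     nu A = (\int[lebesgue_measure]_(x in A) (g x)%:E)%E).

Let mu := @lebesgue_measure R.
Let cl := clamp l r.
Let lr' : l <= r := ltW lr.

(** The map is clamped to [l, r], where its regularity is known, so that it is defined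
and continuous on the whole line. *)
Definition noisy_map x u := T (cl x) + sigma (cl x) * u.

Definition noise_kernel x z := (sigma x)^-1 * g ((z - T x) / sigma x).

Lemma lipschitz_continuous (f : R -> R) k :
  (forall x y, `|f x - f y| <= k * `|x - y|) -> continuous f.
Proof.
move=> fk x; apply/cvgrPdist_le => /= e e0.
have k0 : 0 < `|k| + 1 by rewrite ltr_pwDr.
near=> z; apply: (le_trans (fk _ _)).
have : `|x - z| <= e / (`|k| + 1).
  by near: z; apply: cvgr_dist_le => //; rewrite divr_gt0.
rewrite ler_pdivlMr// => /(le_trans _); apply.
by rewrite mulrC ler_wpM2l// (le_trans (ler_norm _))// lerDl.
Unshelve. all: by end_near. Qed.

Lemma g_continuous : continuous g.
Proof. exact: lipschitz_continuous g_lipschitz. Qed.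

Lemma Tcl_continuous : continuous (T \o cl).
Proof. exact: continuous_comp_clamp. Qed.

Lemma sigmacl_continuous : continuous (sigma \o cl).
Proof.
by move=> x; apply: continuous_comp; [exact: continuous_clamp|exact: sigma_continuous].
Qed.

Lemma sigmacl_ge x : sigma0 <= sigma (cl x).
Proof. by apply: sigma_ge; exact: clamp_in. Qed.

Lemma sigmacl_gt0 x : 0 < sigma (cl x).
Proof. exact: lt_le_trans (sigmacl_ge x). Qed.

Lemma noisy_map_continuous u : continuous (noisy_map^~ u).
Proof.
rewrite /noisy_map => x; apply: cvgD; first exact: Tcl_continuous.
by apply: cvgM; [exact: sigmacl_continuous|exact: cvg_cst].
Qed.

Lemma noisy_map_measurable x : measurable_fun setT (noisy_map x).
Proof.
apply: measurable_funD; first exact: measurable_cst.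
by apply: measurable_funM; first exact: measurable_cst.
Qed.

Lemma noise_kernel_continuous_r x : continuous (noise_kernel x).
Proof.
rewrite /noise_kernel => z; apply: cvgM; first exact: cvg_cst.
apply: (@continuous_comp _ _ _ (fun z => (z - T x) / sigma x)); last exact: g_continuous.
apply: cvgM; last exact: cvg_cst.
by apply: cvgB => //; exact: cvg_cst.
Qed.

Lemma noise_kernel_continuous_l z : continuous (fun x => noise_kernel (cl x) z).
Proof.
have cV : continuous (fun x => (sigma (cl x))^-1).
  move=> x; apply: cvgV; last exact: sigmacl_continuous.
  by rewrite gt_eqF// sigmacl_gt0.
rewrite /noise_kernel => x; apply: cvgM; first exact: cV.
apply: (@continuous_comp _ _ _ (fun x => (z - T (cl x)) / sigma (cl x))); last exact: g_continuous.
apply: cvgM; last exact: cV.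
by apply: cvgB; [exact: cvg_cst|exact: Tcl_continuous].
Qed.

Let B := gmax / sigma0.

Lemma noise_kernel_ge0 x z : 0 <= noise_kernel (cl x) z.
Proof. by rewrite mulr_ge0// invr_ge0 ltW// sigmacl_gt0. Qed.

Lemma noise_kernel_le x z : `|noise_kernel (cl x) z| <= B.
Proof.
rewrite ger0_norm ?noise_kernel_ge0// /B mulrC ler_pM ?invr_ge0 ?(ltW (sigmacl_gt0 _))//.
by rewrite lef_pV2 ?posrE ?sigmacl_gt0// sigmacl_ge.
Qed.

Lemma noise_kernel_lipschitz x z z' :
  `|noise_kernel (cl x) z - noise_kernel (cl x) z'| <= glip / sigma0 ^+ 2 * `|z - z'|.
Proof.
have s0 := sigmacl_gt0 x; have ss := sigmacl_ge x.
have k0 : 0 <= glip.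
  have := g_lipschitz 0 1; rewrite sub0r normrN1 mulr1; exact: le_trans.
rewrite /noise_kernel -mulrBr normrM gtr0_norm ?invr_gt0//.
rewrite ler_pdivrMl//; apply: (le_trans (g_lipschitz _ _)).
rewrite -mulrBl opprB addrA subrK normrM (@gtr0_norm _ (_^-1)) ?invr_gt0//.
rewrite mulrA [leRHS]mulrA mulrAC; apply: ler_wpM2r => //.
rewrite [leRHS]mulrCA; apply: ler_wpM2l => //.
rewrite -[leLHS]div1r ler_pdivrMr//.
rewrite [leRHS]mulrAC ler_pdivlMr ?exprn_gt0// mul1r expr2.
by rewrite ler_pM// ltW.
Qed.

Lemma measurable_noise_kernel :
  measurable_fun setT (fun p : R * R => noise_kernel (cl p.1) p.2).
Proof.
apply: (caratheodory_measurable_fun (f := fun x z => noise_kernel (cl x) z)).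
  by move=> z; apply: continuous_measurable; exact: noise_kernel_continuous_l.
by move=> x; exact: noise_kernel_continuous_r.
Qed.

(** Substitute z = T x + sigma x * u; the noise has support in [-a, a], which is mapped
into [l, r]. *)
Lemma transition_noise_kernel G b x : continuous_bounded G b ->
  transition nu noisy_map G x = \int[mu]_(z in `[l, r]) (G z * noise_kernel (cl x) z).
Proof.
move=> [cG Gb]; set m := T (cl x); set s := sigma (cl x).
have s0 : 0 < s := sigmacl_gt0 x.
have [lm mr] := range (clamp_in lr' x); rewrite -/m -/s in lm mr.
rewrite (@affine_substitution _ _ m s)//; last first.
  by move=> z; apply: cvgM; [exact: cG|exact: noise_kernel_continuous_r].
rewrite /transition (@density_integral _ _ g _ b)//; last 2 first.
- by apply: continuous_measurable; exact: g_continuous.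
- split; last by move=> u.
  by apply: measurable_after_step => // y; exact: noisy_map_measurable.
rewrite [RHS]Rintegral_mkcond; apply: eq_Rintegral => u _.
rewrite /noise_kernel -/m -/s patchE (_ : m + s * u - m = u * s); last by rewrite addrAC subrr add0r mulrC.
rewrite mulfK ?gt_eqF// -mulrA [_^-1 * _]mulrC mulfVK ?gt_eqF//.
case: ifPn => // uI; rewrite g_support ?mulr0//.
rewrite ltNge; apply: contra uI => ua; rewrite inE/= in_itv/= ler_pdivrMr// ler_pdivlMr//.
by move: ua; rewrite ler_norml => /andP[ua1 ua2]; apply/andP; split; nra.
Qed.

Lemma noise_kernel_integral x : \int[mu]_(z in `[l, r]) noise_kernel (cl x) z = 1.
Proof.
have c1 : continuous_bounded (fun=> 1 : R) 1.
  by split => [y|y]; [exact: cst_continuous|rewrite normr1].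
have := transition_noise_kernel x c1; rewrite /transition Rintegral_prob_cst => ->.
by apply: eq_Rintegral => z _; rewrite mul1r.
Qed.

End additive_noise.

(** * Regularity of the noise density and nondegeneracy of the noise *)

(** The mean value theorem on [-(a + 1), a + 1], outside of which f can be evaluated at
the nearest endpoint. *)
Lemma compact_support_lipschitz {R : realType} (f df : R -> R) (a : R) : 0 < a ->
  (forall x : R, is_derive x 1 f (df x)) -> continuous df ->
  (forall x, a < `|x| -> f x = 0) ->
  exists k, 0 <= k /\ forall x y, `|f x - f y| <= k * `|x - y|.
Proof.
move=> a0 dfE cdf f0.
have le1 : - (a + 1) <= a + 1 by lra.
pose C := clamp (- (a + 1)) (a + 1).
have fC x : f x = f (C x).
  have [xI|xI] := boolP (x \in `[- (a + 1), a + 1]); first by rewrite /C clamp_id.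
  have h1 : a + 1 < `|x|.
    by rewrite ltNge; apply: contra xI; rewrite in_itv/= ler_norml.
  rewrite f0; last by lra.
  rewrite f0// /C /clamp; have [x0|x0] := leP 0 x.
    by rewrite ger0_norm// in h1; rewrite min_l ?(ltW h1)// max_r// ger0_norm; lra.
  rewrite ltr0_norm// in h1; rewrite min_r; last by lra.
  rewrite max_l; last by lra.
  by rewrite normrN ger0_norm; lra.
have cn : {within `[- (a + 1), a + 1], continuous (fun x => `|df x|)}.
  apply: continuous_subspaceT => x; apply: continuous_comp; first exact: cdf.
  exact: norm_continuous.
have [c cI cmax] := EVT_max le1 cn.
exists `|df c|; split => //.
have cf : continuous f.
  by move=> x; apply: differentiable_continuous; apply/derivable1_diffP; case: (dfE x).
suff h x y : x <= y -> `|f x - f y| <= `|df c| * `|x - y|.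
  move=> x y; have [xy|/ltW yx] := leP x y; first exact: h.
  by rewrite distrC (distrC x); exact: h.
move=> xy; rewrite fC (fC y).
apply: (@le_trans _ _ (`|df c| * `|C x - C y|)); last first.
  by rewrite ler_wpM2l//; exact: clamp_dist.
have Cxy : C x <= C y by rewrite /C /clamp le_max2// le_min2.
have [t tI E] := MVT_segment Cxy (fun z _ => dfE z) (continuous_subspaceT cf).
rewrite distrC E normrM (distrC (C x)) ler_wpM2r//; apply: cmax.
have := clamp_in le1 x; have := clamp_in le1 y; move: tI; rewrite -/C !in_itv/=.
by move=> /andP[? ?] /andP[? ?] /andP[? ?]; apply/andP; split; lra.
Qed.

Section noise_density_regularity.
Context {R : realType} (chi : R -> R) (a : R).
Hypotheses (a_gt0 : 0 < a) (chi_bump : Defs.bump chi a).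

Lemma noise_density_support x : a < `|x| -> noise_density chi x = 0.
Proof.
by case: chi_bump => _ _ chi0 /chi0 h; rewrite /noise_density h mulr0 mul0r.
Qed.

Lemma noise_density_lipschitz : exists k, 0 <= k /\
  forall x y, `|noise_density chi x - noise_density chi y| <= k * `|x - y|.
Proof.
case: chi_bump => schi _ chi0.
have dchi (x : R) : derivable chi x 1 by have := schi 0%N x.
have ddchi (x : R) : derivable (derive1 chi) x 1 by have := schi 1%N x.
have cont (f : R -> R) : (forall x, derivable f x 1) -> continuous f.
  by move=> df x; apply: differentiable_continuous; apply/derivable1_diffP.
pose c := (\int[lebesgue_measure]_y (chi y * expR (- (y ^+ 2 / 2))))^-1.
pose E (x : R) := expR (- (x ^+ 2 / 2)).
have cE : continuous E.
  move=> x; apply: (@continuous_comp _ _ _ (fun x : R => - (x ^+ 2 / 2))); last exact: continuous_expR.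
  apply: cvgN; apply: cvgM; last exact: cvg_cst.
  exact: exprn_continuous.
have dE (x : R) : is_derive x 1 E (E x * - x).
  rewrite /E; apply: is_derive1_comp.
  apply: is_derive_eq.
  by rewrite !scaler0 add0r -[2^-1 *: _]/(2^-1 * (x * 1 + x * 1)) mulr1; field.
apply: (@compact_support_lipschitz _ (noise_density chi)
  (fun x => c * (derive1 chi x * E x + chi x * (E x * - x))) a) => //.
- move=> x.
  have d1 : is_derive x 1 chi (derive1 chi x).
    by rewrite derive1E; exact: derivableP.
  have -> : noise_density chi = c *: (chi * E).
    by apply/funext => y; rewrite /noise_density -/c -mulrA.
  apply: is_derive_eq.
  rewrite -[_ *: _ in LHS]/(c * _); congr (_ * _).
  by rewrite addrC -[E x *: _]/(E x * _) -[chi x *: _]/(chi x * _) [E x * derive1 chi x]mulrC.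
- move=> x; apply: cvgM; first exact: cvg_cst.
  have cchi := cont _ dchi x; have cdchi := cont _ ddchi x.
  by apply: cvgD; [exact: (cvgM cdchi (@cE x))|
    exact: (cvgM cchi (cvgM (@cE x) (cvgN cvg_id)))].
- exact: noise_density_support.
Qed.

Lemma noise_density_bounded : exists b, forall x, noise_density chi x <= b.
Proof.
have a0 := a_gt0; have [k [k0 lip]] := noise_density_lipschitz.
exists (k * (2 * a + 1)) => x; have [xa|ax] := leP `|x| a; last first.
  by rewrite noise_density_support// mulr_ge0//; lra.
have g0 : noise_density chi (a + 1) = 0.
  by rewrite noise_density_support// ger0_norm; lra.
have := lip x (a + 1); rewrite g0 subr0 => /(le_trans (ler_norm _)) /le_trans; apply.
apply: ler_wpM2l => //; move: xa; rewrite !ler_norml => /andP[? ?]; apply/andP; split; lra.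
Qed.

End noise_density_regularity.

Section sigma_bound.
Context {R : realType} (l r a V : R) (T sigma g : R -> R) (u0 : R).
Hypotheses (lr : l < r) (sigma_continuous : continuous sigma)
  (range : forall x, x \in `[l, r] ->
     l <= T x - a * sigma x /\ T x + a * sigma x < r)
  (a_gt0 : 0 < a) (g_support : forall x, a < `|x| -> g x = 0)
  (g_u0 : 0 < g u0) (V_gt0 : 0 < V)
  (variation_le : {ae @lebesgue_measure R, forall x, x \in `[l, r] ->
     (total_variation l r (noise_kernel T sigma g x) <= V%:E)%E}).

(** Compare the value at T x + sigma x * u0 with the value at r, which is 0. *)
Lemma variation_noise_kernel_ge x : x \in `[l, r] -> 0 < sigma x ->
  ((g u0 / sigma x)%:E <= total_variation l r (noise_kernel T sigma g x))%E.
Proof.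
move=> xI s0; have [lx xr] := range xI; have a0 := a_gt0.
have u0a : `|u0| <= a.
  by rewrite leNgt; apply/negP => /g_support h; move: g_u0; rewrite h ltxx.
pose z := T x + u0 * sigma x.
have /andP[uN uP] : - a <= u0 <= a by rewrite -ler_norml.
have lz : l <= z by rewrite /z; nra.
have zr : z <= r by rewrite /z; nra.
rewrite (total_variationD _ lz zr).
apply: (@le_trans _ _ (total_variation z r (noise_kernel T sigma g x))); last first.
  by rewrite leeDr// total_variation_ge0.
apply: le_trans (total_variation_ge _ zr); rewrite lee_fin.
have -> : noise_kernel T sigma g x r = 0.
  rewrite /noise_kernel g_support ?mulr0//; apply: lt_le_trans (ler_norm _).
  by rewrite ltr_pdivlMr// ltrBrDl.
have -> : noise_kernel T sigma g x z = g u0 / sigma x.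
  by rewrite /noise_kernel /z addrAC subrr add0r mulfK ?gt_eqF// mulrC.
by rewrite sub0r normrN ler_norm.
Qed.

Lemma small_sigma_avoided : {ae @lebesgue_measure R, forall x, x \in `[l, r] ->
   0 < sigma x -> g u0 / V <= sigma x}.
Proof.
have [Z [mZ Z0 sub]] := variation_le; exists Z; split => //.
apply: subset_trans sub => x /=; apply: contra_not => h xI s0.
have := le_trans (variation_noise_kernel_ge xI s0) (h xI); rewrite lee_fin.
by rewrite ler_pdivrMr// => ?; rewrite ler_pdivrMr// mulrC.
Qed.

(** Where sigma is not 0 it is almost everywhere at least g u0 / V.  If it were smaller
at some point, the intermediate value theorem would give a point where it lies
strictly between 0 and this bound, hence an interval of such points, which is
not a null set. *)
Lemma sigma_lower_bound : (exists2 x, x \in `[l, r] & 0 < sigma x) ->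
  forall x, x \in `[l, r] -> g u0 / V <= sigma x.
Proof.
have lr' := lr; move=> [x1 x1I s1] x xI; rewrite leNgt; apply/negP => sx.
set s0 := g u0 / V in sx *.
have s0_gt0 : 0 < s0 by rewrite divr_gt0.
have [y yI /andP[y0 ys]] : exists2 y, y \in `[l, r] & 0 < sigma y < s0.
  have [sxp|] := ltP 0 (sigma x); first by exists x => //; rewrite sxp.
  move=> sx0; have [s1s|s1s] := ltP (sigma x1) s0; first by exists x1 => //; rewrite s1.
  have ivt u v : u <= v -> u \in `[l, r] -> v \in `[l, r] ->
      Num.min (sigma u) (sigma v) <= s0 / 2 <= Num.max (sigma u) (sigma v) ->
      exists2 y, y \in `[l, r] & 0 < sigma y < s0.
    move=> uv uI vI h.
    have [y yI yE] := IVT uv (continuous_subspaceT sigma_continuous) h.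
    exists y; last by rewrite yE; apply/andP; split; lra.
    move: uI vI yI; rewrite !in_itv/= => /andP[? ?] /andP[? ?] /andP[? ?].
    by apply/andP; split; lra.
  have [xx1|/ltW xx1] := leP x x1.
    by apply: (ivt _ _ xx1) => //; rewrite ge_min le_max; apply/andP; split; apply/orP; [left|right]; lra.
  by apply: (ivt _ _ xx1) => //; rewrite ge_min le_max; apply/andP; split; apply/orP; [right|left]; lra.
have [e /= e0 eP] : \forall z \near y, 0 < sigma z < s0.
  have c1 := @cvgr_gt _ _ _ _ sigma _ (@sigma_continuous y) 0 y0.
  have c2 := @cvgr_lt _ _ _ _ sigma _ (@sigma_continuous y) s0 ys.
  by near=> z; apply/andP; (split; near: z); [exact: c1|exact: c2].
pose u := Num.max l (y - e); pose v := Num.min r (y + e).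
have uv : u < v.
  move: yI; rewrite in_itv/= => /andP[ly yr].
  by rewrite /u /v lt_min !gt_max; apply/andP; split; apply/andP; split; lra.
have [Z [mZ Z0 sub]] := small_sigma_avoided.
have uvZ : `]u, v[ `<=` Z.
  move=> z /=; rewrite in_itv/= /u /v gt_max lt_min => /andP[/andP[lz ez] /andP[zr ze]].
  apply: sub => /= h.
  have zI : z \in `[l, r] by rewrite in_itv/= !ltW.
  have /andP[z0 zs] : 0 < sigma z < s0.
    by apply: eP; rewrite /ball/= ltr_norml; apply/andP; split; lra.
  by have := h zI z0; rewrite leNgt zs.
have : (lebesgue_measure `]u, v[ <= lebesgue_measure Z)%E.
  by apply: le_measure => //; rewrite inE.
rewrite Z0 lebesgue_measure_itv/= lte_fin uv -EFinB lee_fin; lra.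
Unshelve. all: by end_near. Qed.

End sigma_bound.

(** * The data of the chain *)

Section chain_facts.
Context {R : realType} (X : chain R).
Let T := ch_T X.
Let c := ch_c X.
Let sigma := ch_sigma X.
Let a := ch_a X.
Let chi := ch_chi X.
Let g := noise_density chi.
Let G := Gamma X.
Let P := ch_P X.

Lemma Gamma_gt0 : 0 < G.
Proof.
by case: (ch_map X) => -[_ Tc1] _ _ _; rewrite /G /Gamma /gap subr_gt0.
Qed.

Lemma Gamma_lt1 : - G < 1.
Proof. have := Gamma_gt0; lra. Qed.

Lemma T_bounds x : x \in `[- G, 1] -> 0 <= T x <= T c.
Proof.
case: (ch_map X) => -[[/andP[c0 c1] _ T01 Tinc Tdec] Tc1] _ _ [_ T0dec TG].
have G0 := Gamma_gt0.
rewrite -/T -/c -/(Gamma X) -/G in c0 c1 T01 Tinc Tdec Tc1 T0dec TG *.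
have T0 : 0 <= T 0 by have /andP[] : 0 <= T 0 <= 1 by apply: T01; rewrite in_itv/= lexx ler01.
rewrite in_itv/= => /andP[Gx x1]; have [x0|x0] := leP 0 x.
  have /andP[-> _] : 0 <= T x <= 1 by apply: T01; rewrite in_itv/= x0.
  have [->|xc] := eqVneq x c; first exact: lexx.
  have [xc'|xc'] := ltP x c.
    by apply/ltW/Tinc => //; rewrite in_itv/=; apply/andP; split; lra.
  have {}xc : c < x by rewrite lt_neqAle eq_sym xc.
  by apply/ltW/Tdec => //; rewrite in_itv/=; apply/andP; split; lra.
apply/andP; split.
  apply/(le_trans T0)/ltW/T0dec => //; rewrite in_itv/=; apply/andP; split; lra.
have [->|xG] := eqVneq x (- G); first exact: ltW.
have {}xG : - G < x by rewrite lt_neqAle eq_sym xG.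
apply/ltW/(lt_trans _ TG)/T0dec => //; rewrite in_itv/=; apply/andP; split; lra.
Qed.

Lemma T_within_continuous : {within `[- G, 1], continuous T}.
Proof.
case: (ch_map X) => -[[_ Tc _ _ _] _] _ _ [[D [D0 Dc _]] _ _].
have -> : [set` `[- G, 1]] = `[- G, 0]%classic `|` `[0, 1]%classic :> set R.
  have G0 := Gamma_gt0; clear D D0 Dc Tc.
  apply/seteqP; split => x /=; rewrite !in_itv/=.
    by move=> /andP[? ?]; have [?|?] := leP x 0; [left|right]; apply/andP; split; lra.
  by move=> [|] /andP[? ?]; apply/andP; split; lra.
apply: withinU_continuous; [exact: interval_closed..| |exact: Tc].
by have := Dc 0%N isT; rewrite D0.
Qed.

Lemma sigma_continuous : continuous sigma.
Proof.
case: (ch_noise X) => _ ds _ _ _ x.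
by apply: differentiable_continuous; apply/derivable1_diffP; exact: ds.
Qed.

Lemma sigma_nonneg x : 0 <= sigma x.
Proof. by case: (ch_noise X). Qed.

Lemma a_positive : 0 < a.
Proof. by case: (ch_noise X). Qed.

Lemma sigma_le_max x : x \in `[- G, 1] -> sigma x <= sigma_max T c sigma.
Proof.
move=> xI; apply: ub_le_sup; last by exists x.
have [y yI ymax] := EVT_max (ltW Gamma_lt1) (continuous_subspaceT sigma_continuous).
by exists (sigma y) => _ [z zI <-]; exact: ymax.
Qed.

(** The inverse of 0 is 0, so the bound on a would give a <= 0 if sigma_max were 0. *)
Lemma sigma_max_gt0 : 0 < sigma_max T c sigma.
Proof.
case: (ch_noise X) => s0 _ a0 ale _.
have : 0 <= sigma_max T c sigma.
  apply: le_trans (sigma_le_max (x := 1) _); first exact: sigma_nonneg.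
  by rewrite in_itv/= lexx ltW// Gamma_lt1.
rewrite le_eqVlt => /predU1P[s|//]; move: ale; rewrite -/T -/c -/sigma -s invr0 mul0r.
by rewrite leNgt a0.
Qed.

Lemma a_sigma_le x : x \in `[- G, 1] -> a * sigma x <= G / 2.
Proof.
move=> xI; have s0 := sigma_max_gt0.
apply: (@le_trans _ _ (a * sigma_max T c sigma)).
  by apply: ler_wpM2l; [exact: ltW a_positive|exact: sigma_le_max].
case: (ch_noise X) => _ _ _ + _; rewrite ler_pdivlMl// mulrC => /le_trans; apply.
by rewrite ge_min lexx.
Qed.

(** T maps the interval into [0, 1 - Gamma] and the noise moves points by at most
Gamma / 2. *)
Lemma chain_range x : x \in `[- G, 1] ->
  - G <= T x - a * sigma x /\ T x + a * sigma x < 1.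
Proof.
move=> xI; have := a_sigma_le xI; have /andP[T0 Tc] := T_bounds xI.
have G0 := Gamma_gt0; have GE : G = 1 - T c by [].
by split; lra.
Qed.

Lemma chi_bump_chain : Defs.bump chi a.
Proof. by case: (ch_noise X). Qed.

Lemma g_nonneg x : 0 <= g x.
Proof. by have [_ h _] := ch_eta_density X 0%N; exact: h. Qed.

Lemma eta_law n (A : set R) : measurable A ->
  distribution P (ch_eta X n) A = (\int[lebesgue_measure]_(x in A) (g x)%:E)%E.
Proof. by have [_ _ h] := ch_eta_density X n; exact: h. Qed.

Lemma g_positive_somewhere : exists u, 0 < g u.
Proof.
apply: contrapT => h; have g0 u : g u = 0.
  apply/eqP; rewrite eq_le g_nonneg andbT leNgt; apply/negP => gu; apply: h.
  by exists u.
have := eta_law 0 (@measurableT _ R).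
have -> : distribution P (ch_eta X 0%N) setT = 1%E by exact: probability_setT.
rewrite (eq_integral (fun=> 0%E)); last by move=> x _; rewrite g0.
by rewrite integral0 => /eqP; rewrite eqe oner_eq0.
Qed.

Lemma chain_sigma_lower_bound : exists2 s0, 0 < s0 &
  forall x, x \in `[- G, 1] -> s0 <= sigma x.
Proof.
have [u gu] := g_positive_somewhere.
have [V V0 Vle] : exists2 V, 0 < V & (esssup_variation (- G) 1 (ch_p X) <= V%:E)%E.
  have := ch_esssup X; rewrite -/G; case: esssup_variation => [v _| //|_].
    by exists (Num.max v 1); [rewrite lt_max ltr01 orbT|rewrite lee_fin le_max lexx].
  by exists 1 => //; exact: leNye.
exists (g u / V); first exact: divr_gt0.
apply: (@sigma_lower_bound _ (- G) 1 a V T sigma g u) => //.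
- exact: Gamma_lt1.
- exact: sigma_continuous.
- exact: chain_range.
- exact: a_positive.
- exact: (noise_density_support chi_bump_chain).
- move: Vle => /ess_supP [Z [mZ Z0 sub]]; exists Z; split => //.
  apply: subset_trans sub => x /=; apply: contra_not => h xI.
  by move: h; rewrite patchE mem_set.
- apply: contrapT => h; have := sigma_max_gt0; rewrite ltNge => /negP; apply.
  apply: ge_sup; first by exists (sigma 1), 1 => //=; rewrite in_itv/= lexx ltW// Gamma_lt1.
  move=> _ [x xI <-]; rewrite leNgt; apply/negP => sx; apply: h.
  by exists x.
Qed.

End chain_facts.

(** * Concentration for the chain *)

Section chain_concentration.
Context {R : realType} (X : chain R).
Let T := ch_T X.
Let sigma := ch_sigma X.
Let g := noise_density (ch_chi X).
Let G := Gamma X.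
Let P := ch_P X.
Let nu : probability R R := distribution P (ch_eta X 0%N).
Let F := noisy_map (- G) 1 T sigma.

Lemma chain_mixing : exists C rho : R, [/\ 0 <= C, 0 <= rho < 1 &
  forall k H b, continuous_bounded H b -> forall x x',
    `|iter k.+1 (transition nu F) H x - iter k.+1 (transition nu F) H x'|
      <= C * rho ^+ k.+1 * b].
Proof.
have lr : - G < 1 := Gamma_lt1 X.
have [s0 s0_gt0 sge] := chain_sigma_lower_bound X.
have [k [k0 lip]] := noise_density_lipschitz (a_positive X) (chi_bump_chain X).
have [gm gle] := noise_density_bounded (a_positive X) (chi_bump_chain X).
have supp := noise_density_support (chi_bump_chain X).
have rng x (xI : x \in `[- G, 1]) : - G <= T x - ch_a X * sigma x /\ T x + ch_a X * sigma x <= 1.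
  by have [? ?] := chain_range xI; split => //; exact: ltW.
have nuE (A : set R) : measurable A -> nu A = (\int[lebesgue_measure]_(x in A) (g x)%:E)%E.
  exact: eta_law.
have g0 := @g_nonneg _ X.
have Tc := @T_within_continuous _ X.
have sc := @sigma_continuous _ X.
apply: (@spectral_gap_mixing _ (- G) 1 (noise_kernel T sigma g) (gm / s0) (k / s0 ^+ 2)) => //.
- exact: measurable_noise_kernel lr Tc sc s0_gt0 sge lip.
- exact: noise_kernel_le.
- exact: noise_kernel_lipschitz.
- exact: (noise_kernel_integral lr s0_gt0 sge rng g0 lip supp nuE).
- exact: noisy_map_measurable.
- exact: noisy_map_continuous.
- by move=> H b x; exact: (transition_noise_kernel lr s0_gt0 sge rng g0 lip supp nuE).
- exact: (ch_spectral_gap X).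
Qed.

(** The map T is constrained on [-Gamma, 1] only, so the chain need not be a measurable
function of the noise where X_0 is outside this interval.  The clamped chain
always is, and it agrees with the chain almost surely. *)
Fixpoint clamped_chain n (w : ch_Omega X) : R :=
  if n is m.+1 then F (clamped_chain m w) (ch_eta X m w) else ch_X X 0%N w.

Lemma clamped_chainE n w : ch_X X 0%N w \in `[- G, 1] -> clamped_chain n w = ch_X X n w.
Proof.
move=> X0; elim: n => // n IH /=; rewrite IH ch_step /F /noisy_map clamp_id//.
case: n {IH} => // n; have G0 := Gamma_gt0 X; have := @ch_orbit _ X n w; rewrite -/G in G0 *.
by rewrite in_itv/= => /andP[? ?]; apply/andP; split; lra.
Qed.

Lemma initial_ae : P.-negligible [set w | ch_X X 0%N w \notin `[- G, 1]].
Proof.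
have [h [_ h0 [mh hge hE]]] := ch_initial X.
have mI : measurable (~` [set` `[- G, 1]] : set R) by apply: measurableC; exact: measurable_itv.
exists (ch_X X 0%N @^-1` (~` [set` `[- G, 1]])); split.
- by rewrite -[X in measurable X]setTI; exact: (measurable_funP _ measurableT).
- rewrite -[LHS]/(distribution P (ch_X X 0%N) _) hE// integral0_eq// => x /=.
  by move=> /negP xI; rewrite h0.
- by move=> w /= /negP.
Qed.

Let clJ := clamp (- (G / 2)) (1 - G / 2).

Lemma Rintegral_clamped_chain (phi : seq R -> R) n :
  measurable_fun setT (fun w => phi [seq clamped_chain i w | i <- iota 1 n]) ->
  measurable_fun setT (fun w => phi [seq ch_X X i w | i <- iota 1 n]) ->
  \int[P]_w phi [seq clamped_chain i w | i <- iota 1 n] =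
  \int[P]_w phi [seq ch_X X i w | i <- iota 1 n].
Proof.
move=> m1 m2; rewrite /Rintegral; congr fine; apply: ae_eq_integral => //.
- exact/measurable_EFinP.
- exact/measurable_EFinP.
- apply: negligibleS initial_ae => w /= h; apply: contra_notN h => X0 _.
  by congr (phi _)%:E; apply: eq_map => i; exact: clamped_chainE.
Qed.

(** From time 1 on the positions lie in an interval of length 1. *)
Theorem chain_concentration : exists2 Cx, 0 < Cx &
  forall L b K l, seq_lipschitz clJ b L K -> all (fun x => 0 <= x) L ->
  \int[P]_w expR (l * K [seq ch_X X i w | i <- iota 1 (size L)]) <=
  expR (l * \int[P]_w K [seq ch_X X i w | i <- iota 1 (size L)] +
        l ^+ 2 * (Cx * \sum_(x <- L) x ^+ 2)).
Proof.
have [C [rho [C0 /andP[rho0 rho1] mix]]] := chain_mixing.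
have lr : - G < 1 := Gamma_lt1 X.
have r1 : 0 < 1 - rho by rewrite subr_gt0.
exists (2 * (1 + C) ^+ 2 / (1 - rho) ^+ 2).
  by rewrite divr_gt0 ?exprn_gt0// mulr_gt0// exprn_gt0// ltr_pwDl.
move=> L b K l nK L0.
have cJ : continuous clJ by apply: continuous_clamp; lra.
have wJ x y : `|clJ x - clJ y| <= 1.
  by apply: le_trans (clamp_width _ x y) _; lra.
pose U n := if n is m.+1 then ch_eta X m else ch_X X 0%N.
have lawU n (A : set R) : measurable A -> distribution P (U n.+1) A = nu A.
  move=> mA; transitivity (\int[lebesgue_measure]_(x in A) (g x)%:E)%E; first exact: eta_law.
  by apply/esym; exact: eta_law.
have Fm : forall x, measurable_fun setT (F x) by move=> x; exact: noisy_map_measurable.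
have Fc : forall u, continuous (F^~ u).
  exact: noisy_map_continuous lr (@T_within_continuous _ X) (@sigma_continuous _ X).
have mCC n : measurable_fun setT (clamped_chain n).
  apply: (@measurable_of_past _ _ _ _ U n).
  by apply: (@measurable_X _ _ _ P U F clamped_chain Fm Fc).
have mK1 : measurable_fun setT (fun w => K [seq clamped_chain i w | i <- iota 1 (size L)]).
  exact: (@measurable_seq_lipschitz _ _ _ clJ b L clamped_chain (fun=> K)).
have mK2 : measurable_fun setT (fun w => K [seq ch_X X i w | i <- iota 1 (size L)]).
  exact: (@measurable_seq_lipschitz _ _ _ clJ b L (ch_X X) (fun=> K)).
rewrite -(Rintegral_clamped_chain mK1 mK2).
rewrite -(@Rintegral_clamped_chain (fun y => expR (l * K y)))//; [|exact: measurable_expRM..].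
have := @random_iteration_concentration _ _ _ P U nu F clamped_chain clJ 1
  (ch_independent X) lawU Fm Fc (fun=> erefl) (fun _ _ => erefl) cJ wJ b C rho C0 rho0 rho1 mix L K l nK L0.
rewrite /states => /le_trans; apply.
rewrite ler_expR lerD2l le_eqVlt; apply/orP; left; apply/eqP.
by field; rewrite gt_eqF.
Qed.

End chain_concentration.

(** * Sub-Gaussian tails and the observed process *)

Section subgaussian.
Context {R : realType} d (T : measurableType d) (P : probability T R).

(** Chernoff's bound. *)
Lemma exponential_markov (Z : T -> R) (b m v l t : R) :
  measurable_fun setT Z -> (forall w, `|Z w| <= b) -> 0 < l ->
  \int[P]_w expR (l * Z w) <= expR (l * m + v) ->
  (P [set w | (m + t <= Z w)%R] <= (expR (v - l * t))%:E)%E.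
Proof.
move=> mZ bZ l0 mgf.
pose X : {RV P >-> R} := HB.pack Z (isMeasurableFun.Build _ _ _ _ _ mZ).
apply: (le_trans (@chernoff _ _ _ P X l (m + t) l0)).
have -> : ('M_P X l = (\int[P]_w expR (l * Z w))%:E)%E.
  rewrite /mmt_gen_fun unlock /Rintegral fineK; last first.
    apply: integrable_fin_num => //; apply: (@bounded_integrable _ _ _ _ _ (expR (`|l| * b))).
      exact: measurable_expRM.
    by move=> w; exact: expRM_bounded.
  by apply: eq_integral => w _; rewrite /= mulrC.
rewrite -EFinM lee_fin.
apply: (le_trans (ler_wpM2r (expR_ge0 _) mgf)).
rewrite -expRD ler_expR; lra.
Qed.

Lemma subgaussian_tail (Z : T -> R) (b m B t : R) :
  measurable_fun setT Z -> (forall w, `|Z w| <= b) -> 0 <= B ->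
  (forall l, \int[P]_w expR (l * Z w) <= expR (l * m + l ^+ 2 * B)) -> 0 < t ->
  (P [set w | (t < `|Z w - m|)%R] <= (2 * expR (- t ^+ 2 / (4 * B)))%:E)%E.
Proof.
move=> mZ bZ; rewrite le_eqVlt => /predU1P[<- _ t0|B0 mgf t0].
  apply: (@le_trans _ _ 1%E); last by rewrite mulr0 invr0 mulr0 expR0 mulr1 lee_fin; lra.
  apply: probability_le1.
  rewrite -[X in measurable X]setTI; apply: (@measurable_fun_ltr _ _ _ _ (cst t) (fun w => `|Z w - m|)) => //.
  by apply: measurableT_comp => //; apply: measurable_funB => //; exact: measurable_cst.
(* The minimizer of l^2 B - l t. *)
pose l := t / (2 * B).
have l0 : 0 < l by rewrite divr_gt0// mulr_gt0.
have mU : measurable [set w | m + t <= Z w].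
  rewrite -[X in measurable X]setTI.
  by apply: (@measurable_fun_ler _ _ _ _ (cst (m + t)) Z) => //; exact: measurable_cst.
have mL : measurable [set w | - m + t <= - Z w].
  rewrite -[X in measurable X]setTI.
  apply: (@measurable_fun_ler _ _ _ _ (cst (- m + t)) (fun w => - Z w)) => //.
  exact: measurableT_comp.
have mA : measurable [set w | t < `|Z w - m|].
  rewrite -[X in measurable X]setTI; apply: (@measurable_fun_ltr _ _ _ _ (cst t) (fun w => `|Z w - m|)) => //.
  by apply: measurableT_comp => //; apply: measurable_funB => //; exact: measurable_cst.
apply: (@le_trans _ _ (P ([set w | m + t <= Z w] `|` [set w | - m + t <= - Z w]))).
  apply: le_measure; rewrite ?inE//; first exact: measurableU.
  move=> w /=; have [zm|zm] := leP 0 (Z w - m).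
    by rewrite ger0_norm// => h; left; lra.
  by rewrite ltr0_norm// => h; right; lra.
apply: (le_trans (measureU2 _ _ _)) => //.
have e : - t ^+ 2 / (4 * B) = l ^+ 2 * B - l * t.
  by rewrite /l; field; rewrite gt_eqF.
rewrite e mulr_natl mulr2n EFinD; apply: leeD.
  exact: (exponential_markov t mZ bZ l0 (mgf l)).
apply: (@exponential_markov (fun w => - Z w) b) => //.
- exact: measurableT_comp.
- by move=> w; rewrite normrN.
- by have := mgf (- l); rewrite sqrrN mulNr -mulrN; under eq_Rintegral do rewrite mulNr -mulrN.
Qed.

End subgaussian.

Section iid.
Context {R : realType} (e : obs_noise R) (s : R).
Hypothesis s_ge0 : 0 <= s.
Let P := ob_P e.
Let clE x : R := s * clamp (-1) 1 x.

(** Independent variables are an iteration whose next position ignores the current one,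
so mixing holds with C = 0 and rho = 0. *)
Lemma iid_concentration L b K l : seq_lipschitz clE b L K -> all (fun x => 0 <= x) L ->
  \int[P]_w expR (l * K [seq ob_eps e i w | i <- iota 1 (size L)]) <=
  expR (l * \int[P]_w K [seq ob_eps e i w | i <- iota 1 (size L)] +
        l ^+ 2 * (8 * s ^+ 2 * \sum_(x <- L) x ^+ 2)).
Proof.
move=> nK L0.
have cE : continuous clE.
  by move=> x; apply: cvgM; [exact: cvg_cst|apply: continuous_clamp; lra].
have wE x y : `|clE x - clE y| <= 2 * s.
  rewrite /clE -mulrBr normrM ger0_norm// mulrC ler_wpM2r//.
  by apply: le_trans (clamp_width _ x y) _; lra.
have := @random_iteration_concentration _ _ _ P (ob_eps e) (distribution P (ob_eps e 1%N))
  (fun _ u => u) (ob_eps e) clE (2 * s) (ob_independent e) _ _ _ (fun=> erefl) (fun _ _ => erefl)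
  cE wE b 0 0 (lexx 0) (lexx 0) ltr01 _ L K l nK L0.
rewrite /states subr0 addr0 => h; apply: (le_trans (h _ _ _ _)).
- by move=> n A mA; rewrite (ob_law e n.+1 mA); apply/esym; exact: ob_law.
- by move=> x; exact: measurable_id.
- by move=> u x; exact: cvg_cst.
- by move=> k G c _ x x'; rewrite /= /transition subrr normr0 !mul0r.
rewrite ler_expR lerD2l le_eqVlt; apply/orP; left; apply/eqP.
by field.
Qed.
End iid.

Section coordinates.
Context {R : realType} (n : nat).
Implicit Types (K : 'rV[R]_n -> R) (Lip : 'I_n -> R).

Lemma seq_lipschitzP (cl : R -> R) b L (K : seq R -> R) :
  (forall y, size y = size L -> `|K y| <= b) ->
  (forall y1 x x' y2, (size y1 + (size y2).+1)%N = size L ->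
     `|K (y1 ++ x :: y2) - K (y1 ++ x' :: y2)| <= nth 0 L (size y1) * `|cl x - cl x'|) ->
  seq_lipschitz cl b L K.
Proof.
elim: L K => [|a L IH] K Kb Klip; first exact: Kb.
split; last by move=> x x' y yL; apply: (Klip [::]); rewrite /= yL.
move=> x; apply: IH => [y yL|y1 z z' y2 sy]; first by apply: Kb; rewrite /= yL.
by apply: (Klip (x :: y1)); rewrite /= -sy.
Qed.

Lemma separately_lipschitz_bounded (cl : R -> R) w L (K : seq R -> R) :
  (forall x x', `|cl x - cl x'| <= w) -> all (fun a => 0 <= a) L ->
  (forall y1 x x' y2, (size y1 + (size y2).+1)%N = size L ->
     `|K (y1 ++ x :: y2) - K (y1 ++ x' :: y2)| <= nth 0 L (size y1) * `|cl x - cl x'|) ->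
  exists b, forall y, size y = size L -> `|K y| <= b.
Proof.
move=> clw; elim: L K => [|a L IH] K.
  by move=> _ _; exists `|K [::]| => y /size0nil ->.
move=> /= /andP[a0 L0] Klip; have [|b Kb] := IH (fun y => K (0 :: y)) L0.
  by move=> y1 x x' y2 sy; apply: (Klip (0 :: y1)); rewrite /= -sy.
exists (b + a * w) => -[//|x y] [yL].
rewrite -[K _](subrK (K (0 :: y))) addrC (le_trans (ler_normD _ _))// lerD ?Kb//.
apply: (le_trans (Klip [::] x 0 y _)); first by rewrite /= yL.
by rewrite ler_wpM2l.
Qed.

Definition lip_seq Lip := [seq Lip j | j <- enum 'I_n].

Lemma size_lip_seq Lip : size (lip_seq Lip) = n.
Proof. by rewrite size_map size_enum_ord. Qed.

Lemma nth_lip_seq Lip (j : 'I_n) : nth 0 (lip_seq Lip) j = Lip j.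
Proof. by rewrite (nth_map j) ?size_enum_ord// nth_ord_enum. Qed.

Context (D : set R) (K : 'rV[R]_n -> R) (Lip : 'I_n -> R).
Hypothesis K_lipschitz : separately_lipschitz D K Lip.

Lemma row_difference (phi : 'I_n -> R -> R) (cl : R -> R) :
  (forall j, 0 <= Lip j) ->
  (forall j x, D (phi j x)) ->
  (forall j x x', `|phi j x - phi j x'| <= `|cl x - cl x'|) ->
  forall y1 x x' y2, (size y1 + (size y2).+1)%N = size (lip_seq Lip) ->
  `|K (\row_j phi j (nth 0 (y1 ++ x :: y2) j)) - K (\row_j phi j (nth 0 (y1 ++ x' :: y2) j))|
    <= nth 0 (lip_seq Lip) (size y1) * `|cl x - cl x'|.
Proof.
move=> Lip0 phiD philip y1 x x' y2; rewrite size_lip_seq => sy.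
have jn : (size y1 < n)%N by rewrite -sy -addSnnS leq_addr.
pose j := Ordinal jn.
rewrite -[size y1]/(nat_of_ord j) nth_lip_seq.
have := K_lipschitz (j := j) (y := \row_j phi j (nth 0 (y1 ++ x :: y2) j))
  (y' := \row_j phi j (nth 0 (y1 ++ x' :: y2) j)).
rewrite !mxE /= !nth_cat ltnn subnn /= => h.
apply: (le_trans (h _ _ _)).
- by move=> i; rewrite mxE.
- by move=> i; rewrite mxE.
- move=> i ij; rewrite !mxE !nth_cat; case: ltnP => // iy.
  have : (size y1 < i)%N.
    by rewrite ltn_neqAle iy andbT; apply: contra ij => /eqP e; apply/eqP/val_inj.
  by rewrite -subn_gt0; case: (i - size y1)%N.
by rewrite ler_wpM2l.
Qed.

End coordinates.

Section observed_functional.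
Context {R : realType} (X : chain R) (e : obs_noise R) (s : R).
Hypotheses (s_gt0 : 0 < s) (s_lt : s < Gamma X / 2).
Context (n : nat) (K : 'rV[R]_n -> R) (Lip : 'I_n -> R).
Hypothesis K_lipschitz : separately_lipschitz `[- Gamma X, 1] K Lip.

Let G := Gamma X.
Let P := ch_P X.
Let Pe := ob_P e.
Let clJ := clamp (- (G / 2)) (1 - G / 2).
Let clE (x : R) : R := s * clamp (-1) 1 x.
Let L := lip_seq Lip.

Lemma lip_ge0 j : 0 <= Lip j.
Proof.
have G0 := Gamma_gt0 X.
have := K_lipschitz (j := j) (y := const_mx 0) (y' := \row_i (if i == j then 1 else 0)).
rewrite !mxE eqxx sub0r normrN1 mulr1 => h; apply: (le_trans _ (h _ _ _)).
- exact: normr_ge0.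
- by move=> i; rewrite mxE /= in_itv/=; apply/andP; split; lra.
- by move=> i; rewrite mxE /= in_itv/=; case: ifP => _; apply/andP; split; lra.
- by move=> i ij; rewrite !mxE (negbTE ij).
Qed.

Lemma lip_seq_ge0 : all (fun a => 0 <= a) L.
Proof. by apply/allP => _ /mapP[j _ ->]; exact: lip_ge0. Qed.

Definition observe (x y : R) : R := clJ x + clE y.

Lemma observe_in x y : [set` `[- G, 1]] (observe x y).
Proof.
have G0 := Gamma_gt0 X; have sG := s_lt; have s0 := s_gt0; rewrite -/G in G0 sG.
have : clJ x \in `[- (G / 2), 1 - G / 2] by apply: clamp_in; lra.
have : clamp (-1) 1 y \in `[-1, 1] by apply: clamp_in; lra.
rewrite /observe /clE /= !in_itv/= => /andP[? ?] /andP[? ?].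
by apply/andP; split; nra.
Qed.

(** The functional in terms of the positions and of the observational noise.  Both are
clamped to the ranges that they have, which makes it Lipschitz on the whole
line in each entry. *)
Definition observed_value (xs ys : seq R) := K (\row_j observe (nth 0 xs j) (nth 0 ys j)).

Lemma K_bounded : exists b, forall y : 'rV[R]_n, (forall i, [set` `[- G, 1]] (y ord0 i)) -> `|K y| <= b.
Proof.
have lr : - G <= 1 := ltW (Gamma_lt1 X).
have h := row_difference K_lipschitz (phi := fun=> clamp (- G) 1) lip_ge0
  (fun _ x => clamp_in lr x) (fun _ x x' => lexx _).
have [b Kb] := @separately_lipschitz_bounded _ _ _ L
  (fun ys => K (\row_j clamp (- G) 1 (nth 0 ys j))) (clamp_width lr) lip_seq_ge0 h.
exists b => y yD; have := Kb [seq y ord0 j | j <- enum 'I_n].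
rewrite size_lip_seq size_map size_enum_ord => /(_ erefl).
congr (`|K _| <= b); apply/rowP => j; rewrite mxE (nth_map j) ?size_enum_ord//.
by rewrite nth_ord_enum clamp_id//; exact: yD.
Qed.

Lemma observed_value_lip_chain ys : forall y1 x x' y2, (size y1 + (size y2).+1)%N = size L ->
  `|observed_value (y1 ++ x :: y2) ys - observed_value (y1 ++ x' :: y2) ys| <= nth 0 L (size y1) * `|clJ x - clJ x'|.
Proof.
apply: (row_difference K_lipschitz (phi := fun j x => observe x (nth 0 ys j)) lip_ge0).
  by move=> j x; exact: observe_in.
by move=> j x x'; rewrite /observe opprD addrACA subrr addr0.
Qed.

Lemma observed_value_lip_noise xs : forall y1 x x' y2, (size y1 + (size y2).+1)%N = size L ->
  `|observed_value xs (y1 ++ x :: y2) - observed_value xs (y1 ++ x' :: y2)| <= nth 0 L (size y1) * `|clE x - clE x'|.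
Proof.
apply: (row_difference K_lipschitz (phi := fun j x => observe (nth 0 xs j) x) lip_ge0).
  by move=> j x; exact: observe_in.
by move=> j x x'; rewrite /observe opprD addrACA subrr add0r.
Qed.

Let states w := [seq ch_X X i w | i <- iota 1 n].
Let noises w := [seq ob_eps e i w | i <- iota 1 n].

Lemma K_observed w : K (observed s n w) = observed_value (states w.1) (noises w.2).
Proof.
congr K; apply/rowP => j; rewrite !mxE /observe /clJ /clE.
rewrite !(nth_map 0%N) ?size_iota// nth_iota// add1n.
rewrite !clamp_id//; last 2 first.
- by have := @ob_range _ e j.+1 w.2; rewrite in_itv.
- by have := @ch_orbit _ X j w.1; rewrite in_itv.
Qed.

Lemma clJ_continuous : continuous clJ.
Proof. by apply: continuous_clamp; lra. Qed.

Lemma clE_continuous : continuous clE.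
Proof.
by move=> x; apply: cvgM; [exact: cvg_cst|apply: continuous_clamp; lra].
Qed.

(** For a fixed trajectory of the chain, K is a functional of the observational noise;
its mean over the noise is again a Lipschitz functional of the trajectory, with
the same constants. *)
Lemma observed_mgf Cx : 
  (forall L b K l, seq_lipschitz clJ b L K -> all (fun x => 0 <= x) L ->
  \int[P]_w expR (l * K [seq ch_X X i w | i <- iota 1 (size L)]) <=
  expR (l * \int[P]_w K [seq ch_X X i w | i <- iota 1 (size L)] +
        l ^+ 2 * (Cx * \sum_(x <- L) x ^+ 2))) ->
  exists b, [/\ measurable_fun setT (fun w : ch_Omega X * ob_Omega e => K (observed s n w)),
    forall w : ch_Omega X * ob_Omega e, `|K (observed s n w)| <= b &
    forall l, \int[(P \x Pe)%E]_w expR (l * K (observed s n w)) <=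
      expR (l * \int[(P \x Pe)%E]_w K (observed s n w) +
        l ^+ 2 * (\sum_(j < n) (Lip j ^+ 2 * (8 * s ^+ 2 + Cx))))].
Proof.
move=> concX; have [b Kb] := K_bounded.
have K2b xs ys : `|observed_value xs ys| <= b by apply: Kb => i; rewrite mxE; exact: observe_in.
have sL : size L = n by exact: size_lip_seq.
have nX ys : seq_lipschitz clJ b L (observed_value^~ ys) by apply: seq_lipschitzP => [y _|]; [exact: K2b|exact: observed_value_lip_chain].
have nE xs : seq_lipschitz clE b L (observed_value xs) by apply: seq_lipschitzP => [y _|]; [exact: K2b|exact: observed_value_lip_noise].
have mZ2 : measurable_fun setT
    (fun w : ch_Omega X * ob_Omega e => observed_value (states w.1) (noises w.2)).
  rewrite /noises -sL.
  apply: (@measurable_seq_lipschitz _ _ _ clE b L (fun i w => ob_eps e i w.2)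
    (fun w : ch_Omega X * ob_Omega e => observed_value (states w.1))) => //.
  - exact: clE_continuous.
  - by move=> i; apply: measurableT_comp => //; exact: measurable_snd.
  - move=> ys _; rewrite /states -sL.
    apply: (@measurable_seq_lipschitz _ _ _ clJ b L (fun i w => ch_X X i w.1)
      (fun w : ch_Omega X * ob_Omega e => observed_value^~ ys)) => //.
    + exact: clJ_continuous.
    + by move=> i; apply: measurableT_comp => //; exact: measurable_fst.
have E : (fun w : ch_Omega X * ob_Omega e => K (observed s n w)) =
    (fun w => observed_value (states w.1) (noises w.2)) by apply/funext => w; exact: K_observed.
exists b; split.
- by rewrite E.
- by move=> w; rewrite K_observed.
move=> l; pose kbar xs := \int[Pe]_w observed_value xs (noises w).
have mE xs : measurable_fun setT (fun w : ob_Omega e => observed_value xs (noises w)).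
  rewrite /noises -sL.
  by apply: (@measurable_seq_lipschitz _ _ _ clE b L (ob_eps e) (fun=> observed_value xs)) => //; exact: clE_continuous.
have nkbar : seq_lipschitz clJ b L kbar.
  apply: seq_lipschitzP => [y _|y1 x x' y2 sy]; first exact: Rintegral_prob_le.
  apply: (@Rintegral_prob_dist _ _ _ _ _ _ b b) => // w.
  exact: observed_value_lip_chain.
under eq_Rintegral do rewrite K_observed.
under [X in l * X]eq_Rintegral do rewrite K_observed.
have mexp : measurable_fun setT (fun p : ch_Omega X * ob_Omega e => expR (l * observed_value (states p.1) (noises p.2))).
  exact: measurable_expRM.
have expb xs ys : `|expR (l * observed_value xs ys)| <= expR (`|l| * b) by exact: expRM_bounded.
rewrite -(@Rintegral_prod _ _ _ _ _ P Pe (fun x y => expR (l * observed_value (states x) (noises y)))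
  _ mexp (fun x y => expb _ _)).
rewrite -(@Rintegral_prod _ _ _ _ _ P Pe (fun x y => observed_value (states x) (noises y))
  _ mZ2 (fun x y => K2b _ _)).
have mkbar : measurable_fun setT (fun w : ch_Omega X => kbar (states w)).
  rewrite /states -sL.
  by apply: (@measurable_seq_lipschitz _ _ _ clJ b L (ch_X X) (fun=> kbar)) => //; exact: clJ_continuous.
have kbarb xs : `|kbar xs| <= b by exact: Rintegral_prob_le.
pose v := 8 * s ^+ 2 * \sum_(x <- L) x ^+ 2.
apply: (@le_trans _ _ (\int[P]_w (expR (l ^+ 2 * v) * expR (l * kbar (states w))))).
  apply: le_Rintegral => //.
  - apply: (@bounded_integrable _ _ _ _ _ (expR (`|l| * b))).
      apply: (@measurable_Rintegral _ _ _ Pe _ _ (fun x y => expR (l * observed_value (states x) (noises y))) (expR (`|l| * b))) => //.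
    by move=> x; apply: Rintegral_prob_le => //; exact: measurable_expRM.
  - apply: (@bounded_integrable _ _ _ _ _ (expR (l ^+ 2 * v) * expR (`|l| * b))).
      by apply: measurable_funM; [exact: measurable_cst|exact: measurable_expRM].
    move=> x; rewrite normrM ger0_norm ?expR_ge0// ler_wpM2l ?expR_ge0//.
    exact: expRM_bounded.
  - move=> w _; rewrite -expRD addrC.
    have := iid_concentration e (ltW s_gt0) l (nE (states w)) lip_seq_ge0.
    by rewrite -/L sL.
rewrite RintegralZl//; last first.
  apply: (@bounded_integrable _ _ _ _ _ (expR (`|l| * b))); first exact: measurable_expRM.
  by move=> x; exact: expRM_bounded.
have := concX L b kbar l nkbar lip_seq_ge0; rewrite sL => cX.
apply: (le_trans (ler_wpM2l (expR_ge0 _) cX)).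
rewrite -expRD ler_expR.
rewrite le_eqVlt; apply/orP; left; apply/eqP.
rewrite addrCA -mulrDr; congr (_ + l ^+ 2 * _).
by rewrite /v /L /lip_seq big_map big_enum/= -mulrDl mulrC mulr_suml.
Qed.

End observed_functional.

Theorem proposition4p1 (R : realType) :
  exists (C_eps : obs_noise R -> R) (C_X : chain R -> R),
    [/\ forall e : obs_noise R, 0 < C_eps e,
        forall X : chain R, 0 < C_X X &
        forall (X : chain R) (e : obs_noise R) (s_M : R),
          0 < s_M -> s_M < Gamma X / 2 ->
        forall (n : nat) (K : 'rV[R]_n -> R) (Lip : 'I_n -> R),
          (0 < n)%N ->
          separately_lipschitz `[- Gamma X, 1] K Lip ->
        forall t : R, 0 < t ->
          let PP := (ch_P X \x ob_P e)%E in
          let Z w := K (observed s_M n w) in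
          (PP [set w | (t < `|Z w - fine 'E_PP[Z]|)%R] <=
           (2 * expR (- t ^+ 2 /
              (4 * \sum_(j < n)
                 (Lip j ^+ 2 * (C_eps e * s_M ^+ 2 + C_X X)))))%:E)%E].
Proof.
pose CX (X : chain R) := s2val (cid2 (chain_concentration X)).
have CX0 X : 0 < CX X by rewrite /CX; case: cid2.
exists (fun=> 8), CX; split; [by move=> _; lra|exact: CX0|move=> X e s s0 sG n K Lip n0 Klip t t0].
have concX := s2valP' (cid2 (chain_concentration X)).
have [b [mZ Zb mgf]] := observed_mgf e s0 sG Klip concX.
cbv zeta; rewrite unlock.
apply: (subgaussian_tail mZ Zb) => //.
apply: sumr_ge0 => j _; rewrite mulr_ge0 ?sqr_ge0//.
by rewrite addr_ge0 ?mulr_ge0 ?sqr_ge0// ltW.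
Qed.
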